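(* Consider the single server retrial queue with the control retrial policy, Poisson arrivals of rate $\lambda$, stationary ergodic service times $\{\sigma_n\}$ with $0<\mathbb{E}\sigma_1<\infty$, and i.i.d. retrial times $\{r_n\}$ with cdf $R(\cdot)$, finite mean and Laplace transform $r^*(\cdot)$, as described in the context. Let $Q_n$ be the number of customers in orbit just after the end of the $n$th service. (i) If $\lambda\,\mathbb{E}\sigma_1<r^*(\lambda)$, then the process $\{Q_n\}$ is strong coupling convergent to a unique stationary ergodic regime. (ii) If $\lambda\,\mathbb{E}\sigma_1>r^*(\lambda)$, then the process $\{Q_n\}$ converges in distribution to an improper limiting sequence.
   Context: **Model (control retrial policy).** Primary customers arrive from outside at a single server according to a Poisson process with rate $\lambda$. A primary customer who finds the server busy upon arrival joins the ''orbit'' to connect later according to the following policy: just after the end of a service time, a generally distributed retrial time begins; if the retrial time finishes before an external arrival, then one customer from the orbit (at the head of the queue or a randomly chosen one, if any) receives its service and leaves the system. The sequence of retrial times $\{r_n\}$ is i.i.d. with density $r(\cdot)$, cdf $R(\cdot)$, Laplace transform $r^*(\cdot)$ and finite mean $\mathbb{E}r_1$. The service durations $\{\sigma_n\}$ form a (strictly) stationary and ergodic sequence with $0<\mathbb{E}\sigma_1<\infty$ (no independence among the $\sigma_n$ is assumed). The inter-arrival times, retrial times and service times are mutually independent. **Embedded process.** Let $Q(t)$ be the number of customers in orbit at time $t$, $s_n$ the instant when the $n$th service time ends, and $Q_n=Q(s_n+)$. Let $N_\lambda(t)$ be the Poisson counting process with parameter $\lambda$ counting the customers arriving during an interval $(0,t]$,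 and let $\gamma_n$ be the residual arrival time of an external call at the end of the $n$th service period. The process $\{Q_n\}$ is represented as the stochastic recursive sequence $$Q_{n+1}=(Q_n+\xi_n)^+,\qquad \xi_n=N_\lambda(\sigma_n)-\mathbb{I}\{r_n<\gamma_n\},$$ where $x^+=\max[0,x]$ and $\mathbb{I}$ denotes the indicator. **Shift.** $\mathcal{F}^\sigma$ is the $\sigma$-algebra generated by the entire sequence $\{\sigma_n:-\infty<n<+\infty\}$, with the convention that any independent sequence not depending on $\{\sigma_n\}$ is also regarded as $\mathcal{F}^\sigma$-measurable. $U$ is the measure preserving shift transformation of $\mathcal{F}^\sigma$-measurable random variables, with $U\sigma_k=\sigma_{k+1}$; $U^n$ is its $n$th iterate and $U^{-n}$ the inverse of $U^n$, $n\in\mathbb{Z}$. **Strong coupling convergence.** Given a stationary sequence $\{Q^n=U^nQ^0\}$, set $\nu_k=\min\{n\ge -k:\ U^{-k}Q_{n+k}=Q^n\}$ and $\nu=\sup_{k\ge 0}\nu_k$. The sequence $\{Q_n\}$ is strong coupling convergent to $\{Q^n\}$ if $\nu<\infty$ with probability $1$. **Improper.** A limiting sequence is improper if its random variables are not almost surely finite, i.e. they take the value $+\infty$ with positive probability.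
   Formalization: In (i) the initial orbit size Q_0, which the text leaves unspecified, is assumed to have finite mean (every deterministic Q_0 qualifies); for arbitrary random Q_0 shifted by U, strong coupling can fail, e.g. if the shifts of Q_0 are i.i.d. with infinite mean. *)

(* Defs.v *)
From HB Require Import structures.
From mathcomp Require Import all_boot all_order all_algebra.
From mathcomp Require Import all_classical all_reals all_analysis.
From mathcomp Require Import measurable_realfun.

Set Implicit Arguments.
Unset Strict Implicit.
Unset Printing Implicit Defensive.

Import Order.TTheory GRing.Theory Num.Theory.
Import numFieldNormedType.Exports.

Local Open Scope classical_set_scope.
Local Open Scope ring_scope.

Section independence.
Context d (T : measurableType d) (R : realType) (P : probability T R).

Definition generated_sigma d' (V : measurableType d') (I : Type) (D : set I)
    (X : I -> T -> V) : set (set T) :=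
  <<s \bigcup_(i in D) preimage_set_system setT (X i) measurable >>.

Definition mutually_independent (I : eqType) (F : I -> set (set T)) : Prop :=
  forall (J : seq I) (E : I -> set T), uniq J ->
    (forall i, i \in J -> F i (E i)) ->
    P (\big[setI/setT]_(i <- J) E i) = (\prod_(i <- J) P (E i))%E.

End independence.

Section shift.
Context d (T : measurableType d) (R : realType) (P : probability T R).

(* [theta n] is the point transformation inducing the [n]th iterate of the
   shift [U], for every integer [n]. *)
Record measure_preserving_flow (theta : int -> T -> T) : Prop := {
  flow0 : forall w, theta 0 w = w ;
  flowD : forall m n w, theta (m + n) w = theta m (theta n w) ;
  flow_measurable : forall n, measurable_fun setT (theta n) ;
  flow_preserves : forall n (A : set T),
    measurable A -> P (theta n @^-1` A) = P A }.

Definition U (theta : int -> T -> T) (V : Type) (n : int) (X : T -> V) : T -> V :=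
  X \o theta n.

Definition shift_sequence (theta : int -> T -> T) (V : Type)
    (X : int -> T -> V) : Prop :=
  forall n k, U theta n (X k) = X (k + n).

(* To be used for sequences such that [shift_sequence theta X]; these are
   strictly stationary when [theta] preserves [P]. *)
Definition ergodic_sequence (theta : int -> T -> T) d' (V : measurableType d')
    (X : int -> T -> V) : Prop :=
  forall A, generated_sigma setT X A -> theta 1 @^-1` A = A ->
    P A = 0%E \/ P A = 1%E.

End shift.

Section poisson_process.
Context d (T : measurableType d) (R : realType) (P : probability T R).

(* [N t] counts the points in (0, t]; only the times t >= 0 are relevant. *)
Record poisson_process (lambda : R) (N : R -> T -> nat) : Prop := {
  poisson_measurable : forall t, 0 <= t -> measurable_fun setT (N t) ;
  poisson_start : forall w, N 0 w = 0%N ;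
  poisson_nondecreasing : forall w s t, 0 <= s -> s <= t -> (N s w <= N t w)%N ;
  poisson_right_continuous : forall w t, 0 <= t ->
    \forall s \near t^'+, N s w = N t w ;
  poisson_increments : forall s t k, 0 <= s -> s < t ->
    P [set w | (N t w - N s w)%N = k] = (poisson_pmf (lambda * (t - s)) k)%:E ;
  poisson_independent_increments : forall t : nat -> R, 0 <= t 0%N ->
    {homo t : i j / (i <= j)%N >-> i <= j} ->
    mutually_independent P
      (fun i : nat => generated_sigma setT
         (fun (_ : unit) w => (N (t i.+1) w - N (t i) w)%N)) }.

End poisson_process.

Section laplace.
Context (R : realType).

Definition laplace_transform (f : R -> R) (s : R) : \bar R :=
  (\int[lebesgue_measure]_(x in `[0%R, +oo[) (expR (- (s * x)) * f x)%:E)%E.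

End laplace.

Section cvg_in_distribution.
Context d (T : measurableType d) (R : realType) (P : probability T R).

Definition cvg_in_distribution (E : topologicalType)
    (Y : nat -> T -> E) (Z : T -> E) : Prop :=
  forall f : E -> R, continuous f -> (exists M, forall x, `|f x| <= M) ->
    ('E_P[f \o Y n] @[n --> \oo] --> 'E_P[f \o Z])%E.

End cvg_in_distribution.

Section retrial_queue.
Context d (T : measurableType d) (R : realType) (P : probability T R).

(* [sigma n]: duration of the [n]th service; [r n]: retrial time started at its
   end; [N n t]: number of external arrivals in the first [t] time units after
   the beginning of the [n]th service. *)
Variables (sigma r : int -> T -> R) (N : int -> R -> T -> nat).

Definition residual_arrival_time (n : int) (w : T) : \bar R :=
  ereal_inf [set t%:E | t in
    [set t | 0 < t /\ (N n (sigma n w) w < N n (sigma n w + t) w)%N]].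

Definition xi (n : int) (w : T) : int :=
  (N n (sigma n w) w)%:Z
  - (((r n w)%:E < residual_arrival_time n w)%E : nat)%:Z.

(* (q + x)^+ *)
Definition orbit_step (q : nat) (x : int) : nat :=
  absz (Num.max 0 (q%:Z + x)).

Fixpoint orbit_size (Q0 : T -> nat) (n : nat) (w : T) : nat :=
  if n is m.+1 then orbit_step (orbit_size Q0 m w) (xi m%:Z w) else Q0 w.

(* The index of independence: the service sequence as a whole ([None]), every
   single retrial time ([inl n]), every single arrival process ([inr n]). *)
Definition driving_sigma (i : option (int + int)) : set (set T) :=
  match i with
  | None => generated_sigma setT sigma
  | Some (inl n) => generated_sigma setT (fun _ : unit => r n)
  | Some (inr n) => generated_sigma [set t : R | 0 <= t] (N n)
  end.

(* The arrivals are described service by service. Services start at stopping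
   times of the arrival stream, so that by the strong Markov property the
   streams seen from the successive starts and used up to the end of the
   following idle period are those of independent Poisson processes [N n]. *)
Record control_retrial_queue (theta : int -> T -> T) (lambda : R)
    (rho : R -> R) : Prop := {
  queue_flow : measure_preserving_flow P theta ;
  service_shift : shift_sequence theta sigma ;
  retrial_shift : shift_sequence theta r ;
  arrival_shift : forall t, 0 <= t -> shift_sequence theta (fun n => N n t) ;
  queue_independent : mutually_independent P driving_sigma ;
  arrival_rate_gt0 : 0 < lambda ;
  arrival_poisson : forall n, poisson_process P lambda (N n) ;
  service_measurable : forall n, measurable_fun setT (sigma n) ;
  service_ge0 : forall n w, 0 <= sigma n w ;
  service_ergodic : ergodic_sequence P theta sigma ;
  service_integrable : P.-integrable setT (EFin \o sigma 1) ;
  service_mean_gt0 : (0 < 'E_P[sigma 1])%E ;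
  retrial_measurable : forall n, measurable_fun setT (r n) ;
  retrial_ge0 : forall n w, 0 <= r n w ;
  retrial_density_measurable : measurable_fun setT rho ;
  retrial_density_ge0 : forall x, 0 <= rho x ;
  retrial_density : forall A : set R, measurable A ->
    P (r 1 @^-1` A) = (\int[lebesgue_measure]_(x in A) (rho x)%:E)%E ;
  retrial_integrable : P.-integrable setT (EFin \o r 1) }.

Variable theta : int -> T -> T.

Definition stationary_ergodic_regime (X : T -> nat) : Prop :=
  [/\ measurable_fun setT X,
      {ae P, forall w, forall n : int,
        U theta (n + 1) X w = orbit_step (U theta n X w) (xi n w)} &
      ergodic_sequence P theta (fun n => U theta n X)].

(* The minimum of a set of integers bounded from below, +oo if it is empty. *)
Definition coupling_time_from (Q : nat -> T -> nat) (X : T -> nat) (k : nat)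
    (w : T) : \bar R :=
  ereal_inf [set (n%:~R)%:E | n in [set n : int |
    - k%:Z <= n /\ U theta (- k%:Z) (Q (absz (n + k%:Z))) w = U theta n X w]].

Definition coupling_time (Q : nat -> T -> nat) (X : T -> nat) (w : T) : \bar R :=
  ereal_sup (range (fun k : nat => coupling_time_from Q X k w)).

Definition strong_coupling_convergent (Q : nat -> T -> nat) (X : T -> nat) : Prop :=
  {ae P, forall w, (coupling_time Q X w < +oo)%E}.

Definition improper (Z : nat -> T -> \bar R) : Prop :=
  forall k, (0 < P [set w | Z k w = +oo%E])%E.

End retrial_queue.

(* Main.v *)
Require Import Defs.
From mathcomp Require Import all_boot all_order all_algebra.
From mathcomp Require Import all_classical all_reals all_analysis.
From mathcomp Require Import measurable_realfun.
From mathcomp Require Import ring lra zify.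

(** The orbit sizes follow Lindley's recursion q' = max(0, q + xi).  After n
    steps from q the size is max(q + S_n, W_n), where S_n is the sum of the n
    increments and W_n is the size reached from an empty orbit
    ([orbit_size_max]).  So everything depends on the growth of S_n, and hence
    on the sign of the mean increment, lambda E(sigma) - r*(lambda), called the
    drift below.

    Growth of sums of a stationary sequence f, f o tau, f o tau^2, and so on, is
    controlled by an argument of Loynes.  Put W_0 = 0 and
    W_(n+1) = max(0, f + W_n o tau), so that W_n is the maximum of the partial
    sums of at most n terms.  As tau preserves the probability,
      E W_(n+1) - E W_n = E (W_(n+1) - W_n o tau) = E max(f, - W_n o tau),
    and the left-hand side is nonnegative.  Where W_n tends to infinity the last
    integrand tends to f, so f has a nonnegative integral over every invariant
    event on which W_n is unbounded ([loynes_Rintegral_ge0]).  If f has negative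
    mean and the invariant events are trivial, then W_n is almost surely
    bounded.  Applied to f + e or to -f + e with a small e > 0, this gives all
    the linear growth that an ergodic theorem would give.

    The hypotheses grant ergodicity only to the service times, whereas the
    increments also involve retrial times and arrivals.  An independent family
    that the shift moves off itself keeps the invariant events trivial
    ([zero_one_independent_extension]).  Let A be invariant, S a service event
    and C an event about finitely many other coordinates.  Comparing the sums of
    1_S - P(S) over A with the bound above gives P(A & S) = P(A) P(S)
    ([invariant_independent]).  The variables 1_S (1_C - P(C)), shifted by
    multiples of a large time, are orthogonal and have the same integral over A,
    which Bessel's inequality forces to be 0.  Hence A is independent of all
    S & C, then of itself.

    The drift is computed by independence.  A customer of the orbit is served
    exactly when no arrival falls in (sigma, sigma + r] ([no_arrival_before]).
    Replacing sigma and r by their upper approximations on a grid turns the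
    expectations into countable sums over fixed times; right continuity of the
    counting process lets the mesh go to 0 ([mean_count], [prob_no_arrival]).

    If the drift is negative, the size at time 0 of a queue left empty at time
    -n increases with n to a finite limit, which solves the recursion.  Two
    solutions driven by the same increments merge as soon as q + S_n <= 0 for
    both starting sizes ([orbit_size_coalesce]), and S_n tends to -oo.  This
    gives uniqueness.  It gives strong coupling too, since the queues started at
    all times -k have sizes at time 0 bounded by one random constant; the
    integrability of the initial size is used there ([stationary_sublinear]).
    If the drift is positive, S_n tends to +oo, so the orbit does, and the limit
    is the constant sequence +oo. *)

Import Order.TTheory GRing.Theory Num.Theory.
Import numFieldNormedType.Exports.

Set Implicit Arguments.
Unset Strict Implicit.
Unset Printing Implicit Defensive.

Local Open Scope classical_set_scope.
Local Open Scope ring_scope.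

(** * Integration along a measure-preserving map *)
Section Rintegral_convergence.
Context d (T : measurableType d) (R : realType) (P : {measure set T -> \bar R}).

Lemma Rdominated_convergence (A : set T) (f_ : nat -> T -> R) (f g : T -> R) :
  measurable A ->
  (forall n, measurable_fun A (f_ n)) -> measurable_fun A f ->
  {ae P, forall w, A w -> f_ ^~ w @ \oo --> f w} ->
  P.-integrable A (EFin \o g) ->
  (forall n, {ae P, forall w, A w -> `|f_ n w| <= g w}) ->
  \int[P]_(w in A) f_ n w @[n --> \oo] --> \int[P]_(w in A) f w.
Proof.
move=> mA mf_ mf cf gi fg.
have mf_E n : measurable_fun A (EFin \o f_ n) by apply/measurable_EFinP.
have mfE : measurable_fun A (EFin \o f) by apply/measurable_EFinP.
have cfE : {ae P, forall w, A w -> (EFin \o f_ n) w @[n --> \oo] --> (EFin \o f) w}.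
  apply: filterS cf => w h Aw; apply: cvg_EFin; [exact: nearW | exact: (h Aw)].
have fgE : {ae P, forall w n, A w -> (`|(EFin \o f_ n) w| <= (EFin \o g) w)%E}.
  apply/ae_foralln => n; apply: filterS (fg n) => w h Aw.
  by rewrite /= lee_fin h.
have [fi _ h] := dominated_convergence mA mf_E mfE cfE gi fgE.
apply: fine_cvg; rewrite fineK //.
exact: (integrable_fin_num mA fi).
Qed.

End Rintegral_convergence.

Section measure_preserving.
Context d (T : measurableType d) (R : realType) (P : probability T R).
Variable tau : T -> T.
Hypothesis mtau : measurable_fun setT tau.
Hypothesis tauP : forall A, measurable A -> P (tau @^-1` A) = P A.

Lemma integrable_comp_preserving (f : T -> R) :
  P.-integrable setT (EFin \o f) -> P.-integrable setT (EFin \o (f \o tau)).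
Proof.
move=> /integrableP[mf fi]; apply/integrableP; split.
  exact: measurableT_comp mf mtau.
suff <- : (\int[P]_x `|(EFin \o f) x| = \int[P]_x `|(EFin \o (f \o tau)) x|)%E by [].
rewrite (eq_measure_integral (pushforward P tau)); last first.
  by move=> A mA _; exact: esym (tauP mA).
by rewrite ge0_integral_pushforward //; exact: measurableT_comp.
Qed.

Lemma Rintegral_comp_preserving (A : set T) (f : T -> R) :
  measurable A -> P.-integrable setT (EFin \o f) ->
  \int[P]_(w in tau @^-1` A) f (tau w) = \int[P]_(w in A) f w.
Proof.
move=> mA fi; rewrite /Rintegral; congr fine.
rewrite [RHS](eq_measure_integral (pushforward P tau)); last first.
  by move=> B mB _; exact: esym (tauP mB).
rewrite integral_pushforward //.
- exact: measurable_int fi.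
- apply: integrableS (integrable_comp_preserving fi) => //.
  by rewrite -(setTI (_ @^-1` _)); exact: mtau.
Qed.

End measure_preserving.

(** * Partial maxima and the maximal ergodic argument *)
Section loynes.
Context (T : Type) (R : realType) (tau : T -> T) (f : T -> R).

(** The maximum of the partial sums of f, f o tau, f o tau^2, ... of length at
    most n, the empty sum included; also the size reached by Lindley's recursion
    from 0 when f, f o tau, ... are the increments read backwards in time. *)
Fixpoint loynes (n : nat) (w : T) : R :=
  if n is m.+1 then Num.max 0 (f w + loynes m (tau w)) else 0.

Definition loynes_unbounded : set T :=
  [set w | forall K : nat, exists n, K%:R < loynes n w].

Lemma loynes_ge0 n w : 0 <= loynes n w.
Proof. by case: n => //= n; rewrite le_max lexx. Qed.

Lemma loynesS n w : loynes n w <= loynes n.+1 w.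
Proof.
elim: n w => [|n IHn] w; first exact: loynes_ge0.
by rewrite [leLHS]/= [leRHS]/= le_max2 // lerD2l IHn.
Qed.

Lemma loynes_homo w : {homo loynes^~ w : m n / (m <= n)%N >-> m <= n}.
Proof.
by apply: homo_leq => [|? ? ?|n]; [exact: lexx|exact: le_trans|exact: loynesS].
Qed.

Lemma sum_le_loynes n w : \sum_(i < n) f (iter i tau w) <= loynes n w.
Proof.
elim: n w => [|n IHn] w; first by rewrite big_ord0.
rewrite big_ord_recl /= le_max; apply/orP; right; rewrite lerD2l.
apply: le_trans (IHn _); rewrite le_eqVlt; apply/orP; left; apply/eqP.
by apply: eq_bigr => i _; rewrite -iterSr.
Qed.

Lemma loynes_unbounded_cvg w : loynes_unbounded w ->
  (fun n => loynes n w) @ \oo --> +oo.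
Proof.
move=> Bw; apply/cvgryPge => K.
have [n hn] := Bw (Num.truncn `|K|).+1.
exists n => // m /= nm; apply: le_trans (loynes_homo w nm).
apply: le_trans (ltW hn); apply: le_trans (ler_norm K) _.
by apply/ltW; rewrite truncnS_gt.
Qed.

Lemma loynes_boundedP w : ~ loynes_unbounded w ->
  exists K : nat, forall n, loynes n w <= K%:R.
Proof.
move=> /existsNP[K] /forallNP hK; exists K => n.
by rewrite leNgt; apply/negP/hK.
Qed.

Lemma loynes_unbounded_invariant : tau @^-1` loynes_unbounded = loynes_unbounded.
Proof.
apply/seteqP; split=> w /= h K.
  have [n hn] := h (Num.truncn (K%:R + `|f w|)).+1.
  exists n.+1; rewrite /= lt_max; apply/orP; right.
  have := truncnS_gt (K%:R + `|f w|); have := ler_norm (- f w); rewrite normrN.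
  by move: hn; lra.
have [[|n] /= hn] := h (Num.truncn (K%:R + `|f w|)).+1.
  by have := ler0n R (Num.truncn (K%:R + `|f w|)).+1; rewrite leNgt hn.
exists n; move: hn; rewrite lt_max; have := truncnS_gt (K%:R + `|f w|).
have := ler_norm (f w); have := normr_ge0 (f w); have := ler0n R K.
by move=> ? ? ? ? /orP[|]; lra.
Qed.

End loynes.

Section loynes_measurable.
Context d (T : measurableType d) (R : realType) (tau : T -> T) (f : T -> R).
Hypothesis mtau : measurable_fun setT tau.
Hypothesis mf : measurable_fun setT f.

Lemma measurable_loynes n : measurable_fun setT (loynes tau f n).
Proof.
elim: n => [|n IHn] /=; first exact: measurable_cst.
apply: measurable_maxr => //; apply: measurable_funD => //.
exact: measurableT_comp.
Qed.

Lemma measurable_loynes_unbounded : measurable (loynes_unbounded tau f).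
Proof.
have -> : loynes_unbounded tau f =
    \bigcap_K \bigcup_n (loynes tau f n @^-1` `]K%:R, +oo[).
  apply/seteqP; split=> w /= h.
    move=> K _; have [n hn] := h K; exists n => //=.
    by rewrite in_itv /= andbT.
  by move=> K; have [n _] := h K I; rewrite /= in_itv /= andbT => ?; exists n.
apply: bigcapT_measurable => K; apply: bigcupT_measurable => n.
by rewrite -(setTI (_ @^-1` _)); exact: measurable_loynes.
Qed.

End loynes_measurable.

Section maximal_ergodic.
Context d (T : measurableType d) (R : realType) (P : probability T R).
Variable tau : T -> T.
Hypothesis mtau : measurable_fun setT tau.
Hypothesis tauP : forall A, measurable A -> P (tau @^-1` A) = P A.
Variable f : T -> R.
Hypothesis fi : P.-integrable setT (EFin \o f).

Let mf : measurable_fun setT f.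
Proof. by apply/measurable_EFinP; exact: measurable_int fi. Qed.

Let W := loynes tau f.

Lemma integrable_loynes n : P.-integrable setT (EFin \o W n).
Proof.
elim: n => [|n IHn] /=.
  exact: (finite_measure_integrable_cst P 0).
have gi := integrable_comp_preserving mtau tauP IHn.
apply: (le_integrable measurableT _ _ (integrableD measurableT
  (integrable_norm fi) gi)).
  by apply/measurable_EFinP; exact: (measurable_loynes mtau mf n.+1).
move=> w _; rewrite /= lee_fin.
have := loynes_ge0 tau f n (tau w) => h.
rewrite (ger0_norm (x := Num.max _ _)); last by rewrite le_max lexx.
rewrite ger0_norm; last by rewrite addr_ge0.
by rewrite ge_max lerD2r ler_norm andbT addr_ge0.
Qed.

(** The increment E W_(n+1) - E W_n, which is nonnegative, is the integral of
    max(f, - W_n o tau), and this converges to f where W_n is unbounded. *)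
Lemma loynes_Rintegral_ge0 (A : set T) : measurable A -> tau @^-1` A = A ->
  A `<=` loynes_unbounded tau f -> 0 <= \int[P]_(w in A) f w.
Proof.
move=> mA Ainv AB.
pose g n w := Num.max (f w) (- W n (tau w)).
(* max(f, - W_n o tau) is the increment W_(n+1) - W_n o tau *)
have WE n w : g n w = W n.+1 w - W n (tau w).
  rewrite /g /W /=; set a := loynes _ _ n _.
  by rewrite addr_maxl sub0r addrK maxC.
have Wi n : P.-integrable A (EFin \o W n) by apply: integrableS (integrable_loynes n).
have Wti n : P.-integrable A (EFin \o (W n \o tau)).
  by apply: integrableS (integrable_comp_preserving mtau tauP (integrable_loynes n)).
have g_ge0 n : 0 <= \int[P]_(w in A) g n w.
  rewrite (@eq_Rintegral _ _ _ _ A (fun w => W n.+1 w - W n (tau w))); last first.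
    by move=> w _; rewrite WE.
  rewrite RintegralB //; last exact: Wti.
  have -> : \int[P]_(w in A) W n (tau w) = \int[P]_(w in A) W n w.
    rewrite -{1}Ainv; apply: Rintegral_comp_preserving => //.
    exact: integrable_loynes.
  rewrite subr_ge0; apply: le_Rintegral => // w _; exact: loynesS.
have fiA : P.-integrable A (EFin \o f) by apply: integrableS fi.
have mg n : measurable_fun A (g n).
  apply: measurable_funTS; apply: measurable_maxr => //.
  apply: measurableT_comp => //; apply: measurableT_comp => //.
  exact: measurable_loynes.
have hc : \int[P]_(w in A) g n w @[n --> \oo] --> \int[P]_(w in A) f w.
  apply: (Rdominated_convergence (g := fun w => `|f w|) mA) => //.
  - exact: measurable_funTS.
  - apply: aeW => w Aw.
    have : loynes_unbounded tau f (tau w) by apply: AB; rewrite -Ainv in Aw.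
    move=> ub; have h := (proj1 (cvgryPge _) (loynes_unbounded_cvg ub)) (- f w).
    apply: cvg_near_cst; near=> n.
    rewrite /= /g; apply/max_idPl; rewrite lerNl; near: n; exact: h.
  - exact: integrable_norm.
  - move=> n; apply: aeW => w Aw; rewrite /g.
    have h := loynes_ge0 tau f n (tau w).
    case: (leP (f w) (- W n (tau w))) => // hW.
    rewrite /W in hW *; rewrite normrN ger0_norm //.
    rewrite ler0_norm; last by apply: le_trans hW _; rewrite oppr_le0.
    by rewrite lerNr.
rewrite -(cvg_lim _ hc) //; apply: limr_ge.
  by apply/cvg_ex; eexists; exact: hc.
exact: nearW.
Unshelve. all: by end_near.
Qed.

End maximal_ergodic.

(** * Zero-one laws for invariant events *)
Section bounded_measurable.
Context d (T : measurableType d) (R : realType) (P : probability T R).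

Definition bounded_measurable (f : T -> R) : Prop :=
  measurable_fun setT f /\ exists M : R, forall w, `|f w| <= M.

Lemma bounded_measurable_cst (c : R) : bounded_measurable (fun=> c).
Proof. by split; [exact: measurable_cst | exists `|c|]. Qed.

Lemma bounded_measurable_indic (A : set T) :
  measurable A -> bounded_measurable (\1_A).
Proof.
move=> mA; split; first exact: measurable_indic.
by exists 1 => w; rewrite indicE ger0_norm //; case: (w \in A).
Qed.

Lemma bounded_measurableD f g : bounded_measurable f -> bounded_measurable g ->
  bounded_measurable (fun w => f w + g w).
Proof.
move=> [mf [M fM]] [mg [N gN]]; split; first exact: measurable_funD.
by exists (M + N) => w; apply: le_trans (ler_normD _ _) _; rewrite lerD.
Qed.

Lemma bounded_measurableM f g : bounded_measurable f -> bounded_measurable g ->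
  bounded_measurable (fun w => f w * g w).
Proof.
move=> [mf [M fM]] [mg [N gN]]; split; first exact: measurable_funM.
by exists (M * N) => w; rewrite normrM ler_pM.
Qed.

Lemma bounded_measurableB f g : bounded_measurable f -> bounded_measurable g ->
  bounded_measurable (fun w => f w - g w).
Proof.
move=> bf bg; have -> : (fun w => f w - g w) = (fun w => f w + -1 * g w).
  by apply/funext => w; rewrite mulN1r.
by apply: bounded_measurableD => //; apply: bounded_measurableM => //;
  exact: bounded_measurable_cst.
Qed.

Lemma bounded_integrable f (D : set T) : measurable D ->
  bounded_measurable f -> P.-integrable D (EFin \o f).
Proof.
move=> mD [mf [M fM]]; apply: (integrableS measurableT) => //.
apply: (le_integrable measurableT _ _ (finite_measure_integrable_cst P M measurableT)).
  exact/measurable_EFinP.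
by move=> w _; rewrite /= lee_fin (le_trans (fM w)) // ler_norm.
Qed.

Lemma Rintegral_indic (D A : set T) : measurable D -> measurable A ->
  \int[P]_(w in D) \1_A w = fine (P (A `&` D)).
Proof. by move=> mD mA; rewrite /Rintegral integral_indic. Qed.

Lemma Rintegral_prob_cst (c : R) : \int[P]_w c = c.
Proof.
transitivity (c * fine (P setT)); first exact: Rintegral_cst.
by rewrite probability_setT mulr1.
Qed.

Lemma Rintegral_setT_indic (A : set T) : measurable A ->
  \int[P]_w \1_A w = fine (P A).
Proof. by move=> mA; rewrite Rintegral_indic // setIT. Qed.

End bounded_measurable.

Section zero_one_law.
Context d (T : measurableType d) (R : realType) (P : probability T R).

Lemma ae_not_null (B : set T) : measurable B -> P B = 0%E -> {ae P, forall w, ~ B w}.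
Proof. by move=> mB B0; exists B; split => // w /= /contrapT. Qed.

Definition zero_one (tau : T -> T) (G : set (set T)) : Prop :=
  forall A, G A -> tau @^-1` A = A -> P A = 0%E \/ P A = 1%E.

Variable tau : T -> T.
Hypothesis mtau : measurable_fun setT tau.
Hypothesis tauP : forall A, measurable A -> P (tau @^-1` A) = P A.

(** The event of unboundedness is invariant; if it had probability 1, f would
    have a nonnegative mean. *)
Lemma loynes_unbounded_null (f : T -> R) :
  P.-integrable setT (EFin \o f) -> \int[P]_w f w < 0 ->
  P (loynes_unbounded tau f) = 0%E \/ P (loynes_unbounded tau f) = 1%E ->
  P (loynes_unbounded tau f) = 0%E.
Proof.
move=> fi f0; set B := loynes_unbounded tau f.
have mf : measurable_fun setT f.
  by apply/measurable_EFinP; exact: measurable_int fi.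
have mB : measurable B by exact: measurable_loynes_unbounded.
case=> // PB.
have PBc : P (~` B) = 0%E by rewrite probability_setC // PB subee.
exfalso; move: f0; apply/negP; rewrite -leNgt.
have := loynes_Rintegral_ge0 mtau tauP fi mB (loynes_unbounded_invariant _ _)
  (@subset_refl _ B).
rewrite -[X in _ -> 0 <= \int[P]_(w in X) _](setUv B) Rintegral_setU //.
- rewrite [X in _ + X](_ : _ = 0) ?addr0 //.
  rewrite /Rintegral null_set_integral //; first exact: measurableC.
  exact: measurable_funTS (measurable_int _ fi).
- exact: measurableC.
- by rewrite setUv.
- by apply/disj_set2P; exact: setICr.
Qed.

(** The partial sums of f = g o tau - g - e telescope, and f has integral
    -e P(B) over the invariant event B where they are unbounded above.  As B is
    used as it stands, g may be any integrable function, in particular the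
    initial orbit size. *)
Lemma stationary_sublinear (g : T -> R) (e : R) : 0 < e ->
  P.-integrable setT (EFin \o g) ->
  {ae P, forall w, exists K : R, forall n, g (iter n tau w) - n%:R * e <= K}.
Proof.
move=> e0 gi; pose f w := g (tau w) - g w - e.
have gti := integrable_comp_preserving mtau tauP gi.
have ei := finite_measure_integrable_cst P e measurableT.
have fi : P.-integrable setT (EFin \o f).
  exact: (integrableB measurableT (integrableB measurableT gti gi) ei).
set B := loynes_unbounded tau f.
have mB : measurable B.
  by apply: measurable_loynes_unbounded => //; apply/measurable_EFinP; exact: measurable_int fi.
have Binv : tau @^-1` B = B by exact: loynes_unbounded_invariant.
have PB : P B = 0%E.
  have iB (u : T -> R) : P.-integrable setT (EFin \o u) -> P.-integrable B (EFin \o u).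
    by apply: integrableS.
  have := loynes_Rintegral_ge0 mtau tauP fi mB Binv (@subset_refl _ B).
  rewrite RintegralB //; [|exact: iB (integrableB measurableT gti gi)|exact: iB].
  rewrite RintegralB //; [|exact: iB|exact: iB].
  have -> : \int[P]_(w in B) g (tau w) = \int[P]_(w in B) g w.
    by rewrite -{1}Binv; exact: Rintegral_comp_preserving.
  rewrite subrr sub0r Rintegral_cst //.
  rewrite oppr_ge0 pmulr_rle0 // => h.
  apply/eqP; rewrite eq_le measure_ge0 andbT -[P B]fineK ?fin_num_measure //.
apply: filterS (ae_not_null mB PB) => w nb.
have [K hK] := loynes_boundedP nb; exists (K%:R + g w) => n.
have := le_trans (sum_le_loynes _ _ n w) (hK n).
suff -> : \sum_(i < n) f (iter i tau w) = g (iter n tau w) - g w - n%:R * e by lra.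
elim: n => [|n IHn]; first by rewrite big_ord0 /= subrr mul0r subr0.
by rewrite big_ord_recr /= IHn /f -natr1; ring.
Qed.

(** The points of almost every orbit visit S with frequency P(S), hence so do
    those of the orbits that fill the invariant event A.  In detail, sums of 1_S - P(S) - e/2 are bounded
    above, so those of P(S) + e - 1_S are unbounded, and the latter function has
    a nonnegative integral over A; the reverse inequality comes from the
    complement of S. *)
Lemma invariant_independent (G : set (set T)) (A S : set T) :
  G `<=` measurable ->
  measurable_fun (setT : set (g_sigma_algebraType G))
    (tau : g_sigma_algebraType G -> g_sigma_algebraType G) ->
  zero_one tau <<s G >> ->
  measurable A -> tau @^-1` A = A -> <<s G >> S ->
  P (A `&` S) = (P A * P S)%E.
Proof.
move=> GT mtauG zo mA Ainv GS.
have GT' B : <<s G >> B -> measurable B.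
  by apply: smallest_sub => //; exact: sigma_algebra_measurable.
pose pr B := fine (P B).
have prE B : measurable B -> (pr B)%:E = P B.
  by move=> mB; rewrite fineK // fin_num_measure.
have key S' : <<s G >> S' -> pr (A `&` S') <= pr A * pr S'.
  move=> GS'; have mS := GT' _ GS'.
  suff aux (e : R) : 0 < e -> pr (A `&` S') <= pr A * pr S' + e.
    by apply/ler_addgt0Pr.
  move=> e0; set p := pr S'.
  pose f w := \1_S' w - (p + e / 2); pose h w := p + e - \1_S' w.
  have bS : bounded_measurable (\1_S' : T -> R) by exact: bounded_measurable_indic.
  have bf : bounded_measurable f.
    by apply: bounded_measurableB bS _; exact: bounded_measurable_cst.
  have bh : bounded_measurable h.
    by apply: bounded_measurableB bS; exact: bounded_measurable_cst.
  have fi : P.-integrable setT (EFin \o f) by exact: bounded_integrable.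
  have hi : P.-integrable setT (EFin \o h) by exact: bounded_integrable.
  have f0 : \int[P]_w f w < 0.
    rewrite RintegralB //; [|exact: bounded_integrable|].
      by rewrite Rintegral_setT_indic // Rintegral_prob_cst -/(pr S') -/p; lra.
    by apply: bounded_integrable => //; exact: bounded_measurable_cst.
  have PB : P (loynes_unbounded tau f) = 0%E.
    apply: loynes_unbounded_null => //; apply: zo.
      apply: (@measurable_loynes_unbounded _ (g_sigma_algebraType G)) => //.
      apply: measurable_funB; last exact: measurable_cst.
      exact: measurable_indic.
    exact: loynes_unbounded_invariant.
  have mBf : measurable (loynes_unbounded tau f).
    by apply: measurable_loynes_unbounded => //; case: bf.
  have mBh : measurable (loynes_unbounded tau h).
    by apply: measurable_loynes_unbounded => //; case: bh.
  have fh : ~` loynes_unbounded tau f `<=` loynes_unbounded tau h.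
    move=> w nf L; have [K hK] := loynes_boundedP nf.
    pose n := (Num.truncn ((K%:R + L%:R) / (e / 2))).+1.
    exists n; apply: lt_le_trans (sum_le_loynes _ _ _ _).
    have -> : \sum_(i < n) h (iter i tau w) =
        n%:R * (e / 2) - \sum_(i < n) f (iter i tau w).
      rewrite mulr_natl -[n in _ *+ n]card_ord -sumr_const -sumrB.
      by apply: eq_bigr => i _; rewrite /h /f; lra.
    rewrite ltrBrDr; apply: le_lt_trans (_ : L%:R + K%:R < _).
      by rewrite lerD2l; apply: le_trans (sum_le_loynes _ _ _ _) (hK n).
    by rewrite addrC -ltr_pdivrMr ?divr_gt0 //; exact: truncnS_gt.
  pose A' := A `&` loynes_unbounded tau h.
  have mA' : measurable A' by exact: measurableI.
  have A'inv : tau @^-1` A' = A'.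
    by rewrite preimage_setI Ainv loynes_unbounded_invariant.
  have := loynes_Rintegral_ge0 mtau tauP hi mA' A'inv (@subIsetr _ _ _).
  (* sums of h are unbounded almost surely, so A' and A differ by a null set *)
  have null D : measurable D -> P (D `&` loynes_unbounded tau h) = P D.
    move=> mD; rewrite -[in RHS](setIT D) -(setUv (loynes_unbounded tau h)) setIUr.
    rewrite measureU //; last 3 first.
    - exact: measurableI.
    - by apply: measurableI => //; exact: measurableC.
    - by rewrite setIACA setICr setI0.
    rewrite [X in (_ + X)%E](_ : _ = 0%E) ?adde0 //.
    apply: (@subset_measure0 _ _ _ P _ (loynes_unbounded tau f)) => //.
      by apply: measurableI => //; exact: measurableC.
    move=> w [_ /= nh]; apply: contrapT => nf; exact: nh (fh _ nf).
  rewrite RintegralB //; last 2 first.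
  - by apply: bounded_integrable => //; exact: bounded_measurable_cst.
  - exact: bounded_integrable.
  rewrite Rintegral_cst // Rintegral_indic // /A' setIA (setIC S').
  rewrite null //; last exact: measurableI.
  rewrite [X in _ * X - _](_ : _ = pr A); last by congr fine; exact: null.
  rewrite -/(pr _) -/p.
  have : pr A <= 1 by rewrite -lee_fin prE // probability_le1.
  have : 0 <= pr A by rewrite fine_ge0.
  by nra.
have h1 := key _ GS.
have h2 : pr (A `&` ~` S) <= pr A * pr (~` S).
  apply: key; rewrite -setTD; exact: sigma_algebraCD.
have mS := GT' _ GS.
have mSc : measurable (~` S) by exact: measurableC.
have mAS : measurable (A `&` S) by exact: measurableI.
have mASc : measurable (A `&` ~` S) by exact: measurableI.
have e1 : pr (~` S) = 1 - pr S.
  by apply: EFin_inj; rewrite EFinB !prE // probability_setC.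
have e2 : pr A = pr (A `&` S) + pr (A `&` ~` S).
  apply: EFin_inj; rewrite EFinD !prE // -[in LHS](setIT A) -(setUv S) setIUr.
  by rewrite measureU // setIACA setICr setI0.
rewrite -!prE // -EFinM; congr EFin.
by apply/eqP; rewrite eq_le h1 /=; move: h2; rewrite e1; lra.
Qed.

End zero_one_law.

Section constant_coefficient.
Context d (T : measurableType d) (R : realType) (P : probability T R).

(** Bessel's inequality for uniformly bounded orthogonal functions: n equal
    coefficients c satisfy n c^2 <= 1. *)
Lemma orthogonal_equal_coefficients (Y : nat -> T -> R) (g : T -> R) (c : R) :
  (forall k, bounded_measurable (Y k)) -> bounded_measurable g ->
  (forall k w, `|Y k w| <= 1) -> (forall w, `|g w| <= 1) ->
  (forall k l, (k < l)%N -> \int[P]_w (Y k w * Y l w) = 0) ->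
  (forall k, \int[P]_w (g w * Y k w) = c) -> c = 0.
Proof.
move=> bY bg Y1 g1 Yorth gY.
pose Z (t : R) n w := \sum_(k < n) Y k w - t * g w.
have bZ t n : bounded_measurable (Z t n).
  apply: bounded_measurableB; last first.
    by apply: bounded_measurableM => //; exact: bounded_measurable_cst.
  elim: n => [|n IHn].
    by under eq_fun do rewrite big_ord0; exact: bounded_measurable_cst.
  by under eq_fun do rewrite big_ord_recr /=; exact: bounded_measurableD.
have iX2 f : bounded_measurable f -> P.-integrable setT (EFin \o (fun w => f w ^+ 2)).
  move=> bf; apply: bounded_integrable => //.
  by under eq_fun do rewrite expr2; exact: bounded_measurableM.
have ZY t n m : (n <= m)%N -> \int[P]_w (Z t n w * Y m w) = - (t * c).
  elim: n => [|n IHn] nm.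
    rewrite -(gY m) -mulNr -RintegralZl //; last first.
      by apply: bounded_integrable => //; exact: bounded_measurableM.
    by apply: eq_Rintegral => w _; rewrite /Z big_ord0 sub0r !mulNr mulrA.
  rewrite -(IHn (ltnW nm)) -[RHS]addr0 -(Yorth n m nm) -RintegralD //;
    try by apply: bounded_integrable => //; exact: bounded_measurableM.
  by apply: eq_Rintegral => w _; rewrite /Z big_ord_recr /= addrAC mulrDl.
have ZZ t n : \int[P]_w (Z t n w ^+ 2) <= n%:R - t * c *+ 2 *+ n + t ^+ 2.
  elim: n => [|n IHn].
    rewrite subr0 add0r -[leRHS](Rintegral_prob_cst P).
    apply: le_Rintegral => //.
    - exact: iX2.
    - by apply: bounded_integrable => //; exact: bounded_measurable_cst.
    move=> w _; rewrite /Z big_ord0 sub0r sqrrN exprMn.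
    rewrite -[leRHS]mulr1 ler_wpM2l ?sqr_ge0 // -(real_normK (num_real (g w))).
    by rewrite expr_le1.
  have -> : \int[P]_w (Z t n.+1 w ^+ 2) = \int[P]_w (Z t n w ^+ 2) +
      (2 * \int[P]_w (Z t n w * Y n w) + \int[P]_w (Y n w ^+ 2)).
    rewrite -RintegralZl //; last first.
      by apply: bounded_integrable => //; exact: bounded_measurableM.
    have b1 : P.-integrable setT (EFin \o (fun w => 2 * (Z t n w * Y n w))).
      apply: bounded_integrable => //; apply: bounded_measurableM.
        exact: bounded_measurable_cst.
      exact: bounded_measurableM.
    have b2 : P.-integrable setT (EFin \o (fun w => Y n w ^+ 2)).
      exact: iX2.
    rewrite -RintegralD // -RintegralD //.
    - apply: eq_Rintegral => w _; rewrite {1}/Z big_ord_recr /=.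
      by rewrite /Z; ring.
    - exact: iX2.
    - exact: (integrableD measurableT b1 b2).
  rewrite ZY //.
  have YY : \int[P]_w (Y n w ^+ 2) <= 1.
    rewrite -[leRHS](Rintegral_prob_cst P); apply: le_Rintegral => //.
    - exact: iX2.
    - by apply: bounded_integrable => //; exact: bounded_measurable_cst.
    - by move=> w _; rewrite -(real_normK (num_real _)) expr_le1.
  rewrite mulrSr -[n.+1%:R]natr1; move: IHn YY.
  set a := \int[P]_w _; set b := \int[P]_w _; set u := _ *+ n.
  by rewrite mulr2n; lra.
(* t = n c minimizes n - 2 t n c + t^2 *)
have key n : (n%:R * c) ^+ 2 <= n%:R.
  have := ZZ (n%:R * c) n.
  have : 0 <= \int[P]_w (Z (n%:R * c) n w ^+ 2).
    by apply: Rintegral_ge0 => w _; exact: sqr_ge0.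
  move=> h1 h2; have := le_trans h1 h2.
  rewrite -mulr_natl -[_ * c *+ 2]mulr_natl => h.
  by move: h; set x := n%:R; nra.
apply/eqP; apply: contraT => c0.
have c2 : 0 < c ^+ 2 by rewrite exprn_even_gt0.
have := key (Num.truncn (c ^+ 2)^-1).+1.
have := truncnS_gt (c ^+ 2)^-1.
set n := (Num.truncn _).+1 => hn.
have n0 : 0 < n%:R :> R by rewrite ltr0n.
rewrite exprMn expr2 -mulrA -[leRHS]mulr1 ler_pM2l //.
have : 1 < n%:R * c ^+ 2 by rewrite -ltr_pdivrMr // div1r.
by move=> /lt_le_trans h /h; rewrite ltxx.
Qed.

End constant_coefficient.

(** * Joining an ergodic sequence with independent coordinates *)
Section independent_extension.
Context d (T : measurableType d) (R : realType) (P : probability T R).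

(** Independence read on an arbitrary finite set of labels, so that the events
    attached to shifted copies of a block can be listed by copy and position. *)
Lemma mutually_independent_reindex (I K : eqType) (F : I -> set (set T))
    (idx : K -> I) (s : seq K) (E : K -> set T) :
  mutually_independent P F -> uniq s -> {in s &, injective idx} ->
  (forall k, k \in s -> F (idx k) (E k)) ->
  P (\big[setI/setT]_(k <- s) E k) = (\prod_(k <- s) P (E k))%E.
Proof.
move=> indep us inj FE.
pose E' i := \bigcap_(k in [set k | k \in s /\ idx k = i]) E k.
have E'E k : k \in s -> E' (idx k) = E k.
  move=> ks; rewrite /E' (_ : [set _ | _] = [set k]) ?bigcap_set1 //.
  by apply/seteqP; split=> l /= => [[ls /inj]|->]; [exact|].
have := indep (map idx s) E'; rewrite map_inj_in_uniq // => /(_ us).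
rewrite !big_map (eq_big_seq E) //.
rewrite (@eq_big_seq _ _ _ _ _ (fun i => P (E' (idx i))) (fun i => P (E i))).
  by apply=> i /mapP[k ks ->]; rewrite E'E //; exact: FE.
by move=> k ks; rewrite E'E.
Qed.

Lemma iter_measurable (tau : T -> T) n :
  measurable_fun setT tau -> measurable_fun setT (iter n tau).
Proof.
move=> mtau; elim: n => [|n IHn]; first exact: measurable_id.
exact: (measurableT_comp mtau IHn).
Qed.

Lemma iter_preserving (tau : T -> T) n A : measurable_fun setT tau ->
  (forall B, measurable B -> P (tau @^-1` B) = P B) ->
  measurable A -> P (iter n tau @^-1` A) = P A.
Proof.
move=> mtau tauP; elim: n A => [//|n IHn] A mA.
rewrite -(tauP A mA); apply: (IHn (tau @^-1` A)).
by rewrite -(setTI (_ @^-1` _)); exact: mtau.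
Qed.

Lemma iter_invariant (tau : T -> T) n A :
  tau @^-1` A = A -> iter n tau @^-1` A = A.
Proof.
move=> h; elim: n => [//|n IHn].
by rewrite -[RHS]IHn -[in RHS]h.
Qed.

Variables (J : choiceType) (F : option J -> set (set T)) (act : J -> J).
Variable tau : T -> T.
Hypothesis mtau : measurable_fun setT tau.
Hypothesis tauP : forall A, measurable A -> P (tau @^-1` A) = P A.
Hypothesis sF : forall i, sigma_algebra setT (F i).
Hypothesis mF : forall i, F i `<=` measurable.
Hypothesis indep : mutually_independent P F.
Hypothesis tauN : forall A, F None A -> F None (tau @^-1` A).
Hypothesis tauS : forall j A, F (Some j) A -> F (Some (act j)) (tau @^-1` A).
Hypothesis act_inj : injective act.
Hypothesis act_wandering :
  forall i j, exists L, forall n, (L <= n)%N -> iter n act i != j.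
Hypothesis zoN : zero_one P tau (F None).

Let iter_act_inj n : injective (iter n act).
Proof. by elim: n => [|n IHn] // i j /= /act_inj /IHn. Qed.

(** Shifting a finite block by multiples of a large enough time makes the
    copies pairwise disjoint. *)
Let wandering_seq (s : seq J) : exists2 L : nat, (0 < L)%N &
  forall k l, (k < l)%N -> {in s &, forall i j, iter (l * L) act i != iter (k * L) act j}.
Proof.
have [L hL] : exists L, forall n, (L <= n)%N -> {in s &, forall i j, iter n act i != j}.
  have h1 i : exists L, forall n, (L <= n)%N -> {in s, forall j, iter n act i != j}.
    elim: s => [|j s [L IH]]; first by exists 0%N.
    have [L' hL'] := act_wandering i j.
    exists (maxn L L') => n; rewrite geq_max => /andP[Ln L'n] k.
    by rewrite inE => /orP[/eqP->|ks]; [exact: hL'|exact: IH].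
  have: forall s' : seq J, exists L, forall n, (L <= n)%N ->
      forall i j, i \in s' -> j \in s -> iter n act i != j.
    elim=> [|i s' [L IH]]; first by exists 0%N.
    have [L' hL'] := h1 i.
    exists (maxn L L') => n; rewrite geq_max => /andP[Ln L'n] k j.
    by rewrite inE => /orP[/eqP->|ks] js; [exact: hL'|exact: IH].
  by move=> /(_ s)[L hL]; exists L => n Ln i j; exact: hL.
exists L.+1 => // k l kl i j si sj; apply/negP => /eqP.
have -> : (l * L.+1 = k * L.+1 + (l - k) * L.+1)%N.
  by rewrite -mulnDl subnKC // ltnW.
rewrite iterD => /iter_act_inj /eqP; apply/negP; apply: hL => //.
by rewrite (leq_trans (leqnSn L)) // leq_pmull // subn_gt0.
Qed.

Let tauN_iter n A : F None A -> F None (iter n tau @^-1` A).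
Proof.
move=> FA; elim: n => [//|n IHn].
rewrite (_ : _ @^-1` _ = tau @^-1` (iter n tau @^-1` A)); first exact: tauN.
by apply/seteqP; split=> w; rewrite /preimage /= -iterSr.
Qed.

Let tauS_iter n j A : F (Some j) A -> F (Some (iter n act j)) (iter n tau @^-1` A).
Proof.
move=> FA; elim: n => [//|n IHn].
rewrite (_ : _ @^-1` _ = tau @^-1` (iter n tau @^-1` A)); first exact: tauS.
by apply/seteqP; split=> w; rewrite /preimage /= -iterSr.
Qed.

Let F_setI i A B : F i A -> F i B -> F i (A `&` B).
Proof.
have [] := proj1 (sigma_algebraP (fun X _ => @subsetT _ X)) (sF i).
by move=> _ _ _; exact.
Qed.

Let F_setT i : F i setT.
Proof. by have [h0 hC _] := sF i; rewrite -(setD0 setT); exact: hC. Qed.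

Let pr A := fine (P A).

Let prE A : measurable A -> (pr A)%:E = P A.
Proof. by move=> mA; rewrite fineK // fin_num_measure. Qed.

Let indicM A B (w : T) : \1_A w * \1_B w = \1_(A `&` B) w :> R.
Proof. by rewrite !indicE in_setI -natrM mulnb. Qed.

Let block (E : J -> set T) (s : seq J) := \big[setI/setT]_(j <- s) E j.

Let measurable_block E s : (forall j, measurable (E j)) -> measurable (block E s).
Proof. by move=> mE; apply: big_ind => // *; exact: measurableI. Qed.

Let preimage_block n E s :
  iter n tau @^-1` block E s = block (fun j => iter n tau @^-1` E j) s.
Proof.
rewrite /block; elim: s => [|j s IHs]; first by rewrite !big_nil.
by rewrite !big_cons preimage_setI IHs.
Qed.

Let prod_preimage_block n E s : uniq s -> (forall j, F (Some j) (E j)) ->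
  (\prod_(j <- s) P (iter n tau @^-1` E j))%E = P (block E s).
Proof.
move=> us FE.
have := @mutually_independent_reindex _ _ F (fun j : J => Some j) s E indep us.
rewrite -/(block E s) => ->.
- apply: eq_big_seq => j _; rewrite iter_preserving //; exact: mF (FE j).
- by move=> ? ? _ _ [].
- by move=> j _; exact: FE.
Qed.

Let indep_block2 k l S E s : uniq s -> F None S ->
  (forall j, F (Some j) (E j)) ->
  {in s &, forall i j, iter k act i != iter l act j} ->
  pr (S `&` (iter k tau @^-1` block E s `&` iter l tau @^-1` block E s)) =
  pr S * (pr (block E s) * pr (block E s)).
Proof.
move=> us FS FE disj.
pose idx (k' : option (bool * J)) : option J :=
  if k' is Some (b, j) then Some (iter (if b then k else l) act j) else None.
pose E' (k' : option (bool * J)) : set T :=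
  if k' is Some (b, j) then iter (if b then k else l) tau @^-1` E j else S.
pose sb (b : bool) := [seq Some (b, j) | j <- s].
have us' : uniq (None :: sb true ++ sb false).
  rewrite /= cat_uniq !map_inj_uniq //; try by move=> ? ? [].
  rewrite us andbT /= mem_cat negb_or.
  apply/andP; split; first by apply/andP; split; apply/mapP => -[].
  by apply/hasPn => _ /mapP[j js ->]; apply/mapP => -[].
have key := @mutually_independent_reindex _ _ F idx _ E' indep us'.
have mE j : measurable (E j) by apply: mF (FE j).
have mpre n D : measurable D -> measurable (iter n tau @^-1` D).
  by move=> mD; rewrite -(setTI (_ @^-1` _)); exact: iter_measurable.
have mS : measurable S by exact: mF FS.
have prblock n := prod_preimage_block n us FE.
apply: EFin_inj; rewrite !EFinM !prE //; do ?exact: measurable_block; last first.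
  by apply: measurableI => //; apply: measurableI; apply: mpre; exact: measurable_block.
move: key; rewrite !big_cons !big_cat !big_map /= !prblock => <- //.
- by rewrite !preimage_block.
- move=> [[b i]|] [[b' j]|] //=.
  rewrite !inE /= !mem_cat => /orP[] /mapP[i' si' [-> ->]] /orP[] /mapP[j' sj' [-> ->]] /=.
  + by move=> [/iter_act_inj ->].
  + by move=> [/eqP]; rewrite (negPf (disj _ _ si' sj')).
  + by move=> [/esym/eqP]; rewrite (negPf (disj _ _ sj' si')).
  + by move=> [/iter_act_inj ->].
- move=> [[b j]|] _ //=; exact: tauS_iter.
Qed.

Let indep_block1 k S E s : uniq s -> F None S ->
  (forall j, F (Some j) (E j)) ->
  pr (S `&` iter k tau @^-1` block E s) = pr S * pr (block E s).
Proof.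
move=> us FS FE.
pose idx (k' : option J) : option J := omap (iter k act) k'.
pose E' (k' : option J) : set T := if k' is Some j then iter k tau @^-1` E j else S.
have us' : uniq (None :: map Some s).
  rewrite /= map_inj_uniq ?us ?andbT; last by move=> ? ? [].
  by apply/mapP => -[].
have key := @mutually_independent_reindex _ _ F idx _ E' indep us'.
have mE j : measurable (E j) by apply: mF (FE j).
have mS : measurable S by exact: mF FS.
have prblock n := prod_preimage_block n us FE.
apply: EFin_inj; rewrite EFinM !prE //; do ?exact: measurable_block; last first.
  apply: measurableI => //; rewrite -(setTI (_ @^-1` _)).
  by apply: iter_measurable => //; exact: measurable_block.
move: key; rewrite !big_cons !big_map /= !prblock => <- //.
- by rewrite !preimage_block.
- by move=> [i|] [j|] //= _ _ [/iter_act_inj ->].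
- move=> [j|] _ //=; exact: tauS_iter.
Qed.

(** The functions 1_S (1_C - P(C)), with C the block event, are orthogonal when
    shifted by suitable multiples of L: given the services, distant copies of C
    are independent.  Since A is invariant, their integrals over A are equal. *)
Let invariant_block A S E s : measurable A -> tau @^-1` A = A ->
  uniq s -> F None S -> (forall j, F (Some j) (E j)) ->
  pr (A `&` (S `&` block E s)) = pr (A `&` S) * pr (block E s).
Proof.
move=> mA Ainv us FS FE.
have [L L0 hL] := wandering_seq s.
set C := block E s; set p := pr C.
have mC : measurable C by apply: measurable_block => j; exact: mF (FE j).
have mS : measurable S by exact: mF FS.
have mpre n D : measurable D -> measurable (iter n tau @^-1` D).
  by move=> mD; rewrite -(setTI (_ @^-1` _)); exact: iter_measurable.
pose Sk k := iter (k * L) tau @^-1` S.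
pose Ck k := iter (k * L) tau @^-1` C.
have mSk k : measurable (Sk k) by exact: mpre.
have mCk k : measurable (Ck k) by exact: mpre.
have bI D : measurable D -> bounded_measurable (\1_D : T -> R).
  exact: bounded_measurable_indic.
have iI D c : measurable D -> P.-integrable setT (EFin \o (fun w : T => c * \1_D w)).
  move=> mD; apply: bounded_integrable => //; apply: bounded_measurableM (bI _ mD).
  exact: bounded_measurable_cst.
have iI1 D : measurable D -> P.-integrable setT (EFin \o (\1_D : T -> R)).
  by move=> mD; apply: bounded_integrable => //; exact: bI.
pose Y k w : R := \1_(Sk k `&` Ck k) w - p * \1_(Sk k) w.
have p01 : 0 <= p <= 1.
  by rewrite fine_ge0 //= -lee_fin prE // probability_le1.
apply/eqP; rewrite -subr_eq0; apply/eqP.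
apply: (@orthogonal_equal_coefficients _ _ _ P Y (\1_A)).
- move=> k; apply: bounded_measurableB; first by apply: bI; exact: measurableI.
  by apply: bounded_measurableM; [exact: bounded_measurable_cst|exact: bI].
- exact: bI.
- move=> k w; rewrite /Y !indicE in_setI ler_norml.
  by case: (w \in Sk k); case: (w \in Ck k) => /=; lra.
- by move=> w; rewrite indicE; case: (w \in A); rewrite ?normr1 ?normr0.
- move=> k l kl.
  have disj : {in s &, forall i j, iter (k * L) act i != iter (l * L) act j}.
    by move=> i j si sj; rewrite eq_sym; exact: hL.
  have FSS : F None (Sk k `&` Sk l) by apply: F_setI; exact: tauN_iter.
  have -> : \int[P]_w (Y k w * Y l w) =
    pr ((Sk k `&` Sk l) `&` (Ck k `&` Ck l)) - p * pr ((Sk k `&` Sk l) `&` Ck l)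
    - p * pr ((Sk k `&` Sk l) `&` Ck k) + p ^+ 2 * pr (Sk k `&` Sk l).
    transitivity (\int[P]_w ((\1_((Sk k `&` Sk l) `&` (Ck k `&` Ck l)) w
       - p * \1_((Sk k `&` Sk l) `&` Ck l) w)
       + (- p * \1_((Sk k `&` Sk l) `&` Ck k) w + p ^+ 2 * \1_(Sk k `&` Sk l) w))).
      apply: eq_Rintegral => w _; rewrite /Y -!indicM; ring.
    have mSS : measurable (Sk k `&` Sk l) by exact: measurableI.
    have mCC : measurable (Ck k `&` Ck l) by exact: measurableI.
    have m1 : measurable ((Sk k `&` Sk l) `&` (Ck k `&` Ck l)) by exact: measurableI.
    have m2 : measurable ((Sk k `&` Sk l) `&` Ck l) by exact: measurableI.
    have m3 : measurable ((Sk k `&` Sk l) `&` Ck k) by exact: measurableI.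
    rewrite RintegralD //; last 2 first.
    + exact: (integrableB measurableT (iI1 _ m1) (iI _ p m2)).
    + exact: (integrableD measurableT (iI _ (- p) m3) (iI _ (p ^+ 2) mSS)).
    rewrite RintegralB //; [|exact: iI1|exact: iI].
    rewrite RintegralD //; [|exact: iI|exact: iI].
    rewrite !RintegralZl //; try exact: iI1.
    by rewrite !Rintegral_setT_indic // -/(pr _) -/(pr _) -/(pr _) -/(pr _); ring.
  by rewrite indep_block2 // !indep_block1 // -/C -/p; ring.
- move=> k.
  have kA : iter (k * L) tau @^-1` A = A by exact: iter_invariant.
  have m1 : measurable (A `&` (Sk k `&` Ck k)) by do 2 apply: measurableI => //.
  have m2 : measurable (A `&` Sk k) by exact: measurableI.
  transitivity (\int[P]_w (\1_(A `&` (Sk k `&` Ck k)) w - p * \1_(A `&` Sk k) w)).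
    by apply: eq_Rintegral => w _; rewrite /Y -!indicM; ring.
  rewrite RintegralB //; [|exact: iI1|exact: iI].
  rewrite RintegralZl //; last exact: iI1.
  rewrite !Rintegral_setT_indic // mulrC.
  have e1 : A `&` (Sk k `&` Ck k) = iter (k * L) tau @^-1` (A `&` (S `&` C)).
    by rewrite !preimage_setI kA.
  have e2 : A `&` Sk k = iter (k * L) tau @^-1` (A `&` S).
    by rewrite preimage_setI kA.
  have mAS : measurable (A `&` S) by exact: measurableI.
  have mASC : measurable (A `&` (S `&` C)) by do 2 apply: measurableI => //.
  by rewrite e1 e2 !iter_preserving.
Qed.

(** An invariant event is independent of every event of the form S & C with S in
    [F None] and C depending on finitely many coordinates.  These form a
    pi-system generating the joint sigma-algebra, so the event is independent of
    itself. *)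
Theorem zero_one_independent_extension : zero_one P tau <<s \bigcup_i F i >>.
Proof.
move=> A GA Ainv.
have GT : \bigcup_i F i `<=` measurable by move=> B [i _ FB]; exact: mF FB.
have mA : measurable A.
  by apply: smallest_sub GA => //; exact: sigma_algebra_measurable.
have prAS S : F None S -> P (A `&` S) = (P A * P S)%E.
  move=> FS; apply: (@invariant_independent _ _ _ P tau _ _ (F None)) => //.
  - move=> _ B GB; rewrite setTI; apply: sub_sigma_algebra.
    by apply: tauN; rewrite -(sigma_algebra_id (sF None)).
  - by rewrite sigma_algebra_id.
  - exact: sub_sigma_algebra.
(* families E equal to setT off a finite set make stability under
   intersection coordinatewise *)
pose Pi := [set D | exists E : option J -> set T, exists2 s : seq J,
  (forall i, F i (E i)) /\ (forall j, j \notin s -> E (Some j) = setT) &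
  D = \bigcap_i E i].
have PiE E s : uniq s -> (forall j, j \notin s -> E (Some j) = setT) ->
    \bigcap_i E i = E None `&` block (E \o Some) s.
  move=> us Es; rewrite /block -bigcap_seq; apply/seteqP; split => w /=.
    by move=> h; split; [exact: h | move=> j _; exact: h].
  move=> [h0 h] [j|] _ //; have [js|js] := boolP (j \in s); first exact: h.
  by rewrite Es.
have mPi : Pi `<=` measurable.
  move=> _ [E [s [FE Es] ->]]; rewrite (PiE _ (undup s)) ?undup_uniq //.
    apply: measurableI; first exact: mF (FE None).
    by apply: measurable_block => j; exact: mF (FE (Some j)).
  by move=> j; rewrite mem_undup; exact: Es.
have PiI : setI_closed Pi.
  move=> _ _ [E1 [s1 [FE1 Es1] ->]] [E2 [s2 [FE2 Es2] ->]].
  exists (fun i => E1 i `&` E2 i); exists (s1 ++ s2); last by rewrite bigcapI.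
  split=> [i|j]; first exact: F_setI.
  by rewrite mem_cat negb_or => /andP[j1 j2]; rewrite Es1 // Es2 // setIT.
have PiT : Pi setT.
  exists (fun=> setT); exists [::]; first by split=> // i; exact: F_setT.
  by apply/seteqP; split=> w.
have GPi : <<s \bigcup_i F i >> `<=` <<s Pi >>.
  apply: smallest_sub; first exact: smallest_sigma_algebra.
  move=> B [i _ FB].
  apply: sub_sigma_algebra.
  exists (fun i' => if i' == i then B else setT).
  exists (if i is Some j then [:: j] else [::]).
    split=> [i'|j]; first by case: eqP => [->|_] //; exact: F_setT.
    by case: (i) => [j'|//]; rewrite inE => jj'; case: eqP => [[jj]|//]; rewrite jj eqxx in jj'.
  apply/seteqP; split=> w /=; last by move/(_ i I); rewrite eqxx.
  by move=> Bw i' _; case: eqP.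
have prA01 : 0 <= pr A by exact: fine_ge0.
have h : \bigcup_(k : nat) setT = [set: T] ->
    (forall D, Pi D -> P (D `&` A) = ((pr A)%:E * P D)%E) ->
    (forall k : nat, (P (setT `&` A) < +oo)%E) ->
    P (A `&` A) = ((pr A)%:E * P A)%E.
  move=> h1 h2 h3; exact: (@g_sigma_algebra_measure_unique _ R _ Pi mPi
    (fun=> setT) (fun=> PiT) h1 (mrestr P mA) (mscale (NngNum prA01) P)
    PiI h2 h3 A (GPi _ GA)).
rewrite setIid in h.
have {h} : P A = (P A * P A)%E.
  rewrite -[X in (X * _)%E]prE //; apply: h; first by rewrite bigcup_const //; exists 0%N.
    move=> _ [E [s [FE Es] ->]]; rewrite (PiE _ (undup s)) ?undup_uniq //; last first.
      by move=> j; rewrite mem_undup; exact: Es.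
    set C := block _ _.
    have mC : measurable C by apply: measurable_block => j; exact: mF (FE (Some j)).
    have mS : measurable (E None) by exact: mF (FE None).
    have mSC : measurable (E None `&` C) by exact: measurableI.
    have mAS : measurable (A `&` E None) by exact: measurableI.
    have hASC := invariant_block mA Ainv (undup_uniq s) (FE None) (fun j => FE (Some j)).
    have hSC := indep_block1 0 (undup_uniq s) (FE None) (fun j => FE (Some j)).
    have hAS : pr (A `&` E None) = pr A * pr (E None).
      by apply: EFin_inj; rewrite EFinM !prE //; exact: prAS.
    rewrite setIC -!prE //; last exact: measurableI.
    by rewrite -EFinM; congr EFin; rewrite hASC hAS hSC mulrA.
  by move=> _; rewrite setTI ltey_eq fin_num_measure.
rewrite -!prE // -EFinM => -[] /eqP; rewrite -subr_eq0 -[X in X - _]mulr1 -mulrBr.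
rewrite mulf_eq0 => /orP[/eqP->|]; first by left.
by rewrite subr_eq0 => /eqP <-; right.
Qed.

End independent_extension.

(** * A counting process evaluated at a random time *)
Section measurable_nat.
Context d (T : measurableType d).

Lemma measurable_nat_fibers (f : T -> nat) :
  (forall k, measurable (f @^-1` [set k])) -> measurable_fun setT f.
Proof.
move=> mf _ Y _; rewrite setTI.
rewrite (_ : f @^-1` Y = \bigcup_(k in Y) (f @^-1` [set k])); last first.
  by apply/seteqP; split=> w /=; [exists (f w) | move=> [k Yk /= ->]].
by apply: bigcup_measurable => k _; exact: mf.
Qed.

Lemma measurable_nat_fiber (f : T -> nat) k :
  measurable_fun setT f -> measurable (f @^-1` [set k]).
Proof. by move=> mf; rewrite -(setTI (_ @^-1` _)); exact: mf. Qed.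

Lemma measurable_nat_pick d' (V : sigmaRingType d') (f : T -> nat)
    (g : nat -> T -> V) :
  measurable_fun setT f -> (forall k, measurable_fun setT (g k)) ->
  measurable_fun setT (fun w => g (f w) w).
Proof.
move=> mf mg _ Y mY; rewrite setTI.
rewrite (_ : _ @^-1` Y = \bigcup_k (f @^-1` [set k] `&` g k @^-1` Y)); last first.
  by apply/seteqP; split=> w /=; [exists (f w) | move=> [k _ [/= ->]]].
apply: bigcupT_measurable => k; apply: measurableI.
  exact: measurable_nat_fiber.
by rewrite -(setTI (_ @^-1` _)); exact: mg.
Qed.

Lemma measurable_nat_eventually (f_ : nat -> T -> nat) (f : T -> nat) :
  (forall m, measurable_fun setT (f_ m)) ->
  (forall w, \forall m \near \oo, f_ m w = f w) -> measurable_fun setT f.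
Proof.
move=> mf_ ff; apply: measurable_nat_fibers => k.
rewrite (_ : _ @^-1` _ = \bigcup_M \bigcap_(m in [set m | (M <= m)%N])
    (f_ m @^-1` [set k])); last first.
  apply/seteqP; split=> w /=.
    by move=> <-; have [M _ hM] := ff w; exists M => // m /= Mm; exact: hM.
  move=> [M _ hM]; have [M' _ hM'] := ff w.
  rewrite -(hM' (maxn M M')) /= ?leq_maxr //.
  by have /= := hM (maxn M M') (leq_maxl _ _).
apply: bigcupT_measurable => M; apply: bigcap_measurable; first by exists M => /=.
by move=> m _; exact: measurable_nat_fiber.
Qed.

Lemma measurable_natr (R : realType) (f : T -> nat) :
  measurable_fun setT f -> measurable_fun setT (fun w => (f w)%:R : R).
Proof.
move=> mf; apply: (@measurable_nat_pick _ R f (fun k _ => k%:R) mf) => k.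
exact: measurable_cst.
Qed.

End measurable_nat.

Section grid.
Context (R : realType).

(** The grid of mesh 1/(m+1) approximates x strictly from above by
    [grid_above m x], because counting paths are continuous from the right
    only. *)
Definition grid_index (m : nat) (x : R) : nat := Num.truncn (m.+1%:R * x).
Definition grid_point (m k : nat) : R := k.+1%:R / m.+1%:R.
Definition grid_above (m : nat) (x : R) : R := grid_point m (grid_index m x).

Lemma measurable_truncn : measurable_fun setT (Num.truncn : R -> nat).
Proof.
apply: measurable_nat_fibers => k.
have mle n : measurable [set x : R | (Num.truncn x <= n)%N].
  rewrite (_ : [set _ | _] = `]-oo, n.+1%:R[%classic); first exact: measurable_itv.
  by apply/seteqP; split=> x /=; rewrite truncn_le_nat in_itv.
case: k => [|k].
  rewrite (_ : _ @^-1` _ = [set x : R | (Num.truncn x <= 0)%N]) //.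
  by apply/seteqP; split=> x /=; [move=> -> | rewrite leqn0 => /eqP].
rewrite (_ : _ @^-1` _ = [set x : R | (Num.truncn x <= k.+1)%N] `\`
    [set x : R | (Num.truncn x <= k)%N]); first exact: measurableD.
apply/seteqP; split=> x /=; first by move=> ->; rewrite leqnn ltnn.
by move=> [h1 /negP]; rewrite -ltnNge => h2; apply/eqP; rewrite eqn_leq h1.
Qed.

Lemma measurable_grid_index m : measurable_fun setT (grid_index m).
Proof.
apply: measurableT_comp measurable_truncn _.
by apply: measurable_funM => //; exact: measurable_cst.
Qed.

Lemma grid_point_gt0 m k : 0 < grid_point m k.
Proof. by rewrite divr_gt0 // ltr0n. Qed.

Lemma grid_above_gt m x : x < grid_above m x.
Proof.
by rewrite /grid_above /grid_point ltr_pdivlMr ?ltr0n // mulrC truncnS_gt.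
Qed.

Lemma grid_above_le m x : 0 <= x -> grid_above m x <= x + m.+1%:R^-1.
Proof.
move=> x0; rewrite /grid_above /grid_point ler_pdivrMr ?ltr0n //.
rewrite mulrDl mulVf ?pnatr_eq0 // -natr1 lerD2r mulrC truncn_le.
by rewrite mulr_ge0.
Qed.

Lemma grid_above_cvg x : 0 <= x -> grid_above m x @[m --> \oo] --> x.
Proof.
move=> x0; apply: (@squeeze_cvgr _ _ _ _ (fun=> x) (fun m => x + m.+1%:R^-1)).
- by apply: nearW => m; rewrite (ltW (grid_above_gt _ _)) grid_above_le.
- exact: cvg_cst.
- rewrite -[X in _ --> X]addr0; apply: cvgD; first exact: cvg_cst.
  exact: cvg_harmonic.
Qed.

Lemma right_continuous_eventually (n : R -> nat) (x : R) (u : nat -> R) :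
  (\forall s \near x^'+, n s = n x) -> (forall m, x < u m) ->
  u @ \oo --> x -> \forall m \near \oo, n (u m) = n x.
Proof.
move=> [e /= e0 h] xu cu.
have /cvgrPdist_lt/(_ e e0) := cu; apply: filterS => m hm.
by apply: h => //=; exact: xu.
Qed.

End grid.

Lemma measurable_grid_above d (T : measurableType d) (R : realType)
    (s : T -> R) m :
  measurable_fun setT s -> measurable_fun setT (fun w => grid_above m (s w)).
Proof.
move=> ms; apply: (@measurable_nat_pick _ _ _ _ (grid_index m \o s)
  (fun k _ => grid_point R m k)) => [|k]; last exact: measurable_cst.
exact: (measurableT_comp (@measurable_grid_index R m) ms).
Qed.

Section path.
Context (R : realType) (n : R -> nat).
Hypothesis n_homo : forall s t : R, 0 <= s -> s <= t -> (n s <= n t)%N.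
Hypothesis n_rc : forall t : R, 0 <= t -> \forall s \near t^'+, n s = n t.

(** If there is an arrival in (s, s + r], then r itself lies in the set.  If
    there is none, right continuity at s + r keeps the set at a positive
    distance above r, which makes the inequality strict. *)
Lemma no_arrival_before (s r : R) : 0 <= s -> 0 <= r ->
  (r%:E < ereal_inf [set t%:E | t in
     [set t : R | 0 < t /\ (n s < n (s + t))%N]%R])%E
  = (n (s + r) == n s).
Proof.
move=> s0 r0; apply/idP/eqP => [h|h].
  apply/eqP; apply: contraT => ne; have : (n s < n (s + r))%N.
    by rewrite ltn_neqAle eq_sym ne n_homo // lerDl.
  move=> lt; suff : (ereal_inf [set t%:E | t in [set t : R | 0 < t /\ (n s < n (s + t))%N]%R]
      <= r%:E)%E by rewrite leNgt h.
  apply: ereal_inf_lbound; exists r => //=; split => //.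
  by rewrite lt_neqAle r0 andbT; apply: contraNneq ne => <-; rewrite addr0.
have [e /= e0 he] := n_rc (addr_ge0 s0 r0).
apply: (@lt_le_trans _ _ (r + e / 2)%:E); first by rewrite lte_fin ltrDl divr_gt0.
apply: le_ereal_inf_tmp => _ [t [t0 st] <-]; rewrite lee_fin leNgt; apply/negP => tre.
move: st; rewrite -h ltnNge => /negP; apply.
have [tr|rt] := leP t r; first by rewrite n_homo ?lerD2l // addr_ge0 // ltW.
rewrite (he (s + t)) // ?ltrD2l //=.
by rewrite ltr_norml; apply/andP; split; lra.
Qed.

End path.

Section counting_at_random_time.
Context d (T : measurableType d) (R : realType) (N : R -> T -> nat).
Hypothesis mN : forall t, 0 <= t -> measurable_fun setT (N t).
Hypothesis N_rc : forall w t, 0 <= t -> \forall s \near t^'+, N s w = N t w.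

Lemma count_grid_eventually (s : T -> R) w : 0 <= s w ->
  \forall m \near \oo, N (grid_above m (s w)) w = N (s w) w.
Proof.
move=> s0; apply: (@right_continuous_eventually _ (N ^~ w)).
- exact: N_rc.
- by move=> m; exact: grid_above_gt.
- exact: grid_above_cvg.
Qed.

Lemma measurable_count_at (s : T -> R) :
  measurable_fun setT s -> (forall w, 0 <= s w) ->
  measurable_fun setT (fun w => N (s w) w).
Proof.
move=> ms s0.
apply: (@measurable_nat_eventually _ _ (fun m w => N (grid_above m (s w)) w)).
  move=> m; apply: (@measurable_nat_pick _ _ _ _ (grid_index m \o s)
    (fun k => N (grid_point R m k))).
    exact: (measurableT_comp (@measurable_grid_index R m) ms).
  by move=> k; apply: mN; exact: ltW (grid_point_gt0 _ _ _).
by move=> w; exact: count_grid_eventually.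
Qed.

End counting_at_random_time.

(** * Mean number of arrivals and probability of a retrial *)
Section countable_partition.
Context d (T : measurableType d) (R : realType) (P : {measure set T -> \bar R}).
Local Open Scope ereal_scope.

Lemma fibers_trivIset (kappa : T -> nat) (B : set T) :
  trivIset setT (fun k => B `&` kappa @^-1` [set k]).
Proof.
apply/trivIsetP => i j _ _ ij.
by apply/seteqP; split=> w //= [[_ ->] [_ /eqP]]; rewrite (negPf ij).
Qed.

Lemma bigcup_fibers (kappa : T -> nat) (B : set T) :
  \bigcup_k (B `&` kappa @^-1` [set k]) = B.
Proof. by apply/seteqP; split=> w /=; [move=> [k _ []] | exists (kappa w)]. Qed.

Lemma ge0_integral_partition (kappa : T -> nat) (B : set T) (h : T -> \bar R) :
  measurable_fun setT kappa -> measurable B -> measurable_fun B h ->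
  (forall w, 0 <= h w) ->
  \int[P]_(w in B) h w =
  \sum_(0 <= k <oo) \int[P]_(w in B `&` kappa @^-1` [set k]) h w.
Proof.
move=> mk mB mh h0; rewrite -[in LHS](bigcup_fibers kappa B) ge0_integral_bigcup //.
- by move=> k; apply: measurableI => //; exact: measurable_nat_fiber.
- by rewrite bigcup_fibers.
- exact: fibers_trivIset.
Qed.

End countable_partition.

Section probability_partition.
Context d (T : measurableType d) (R : realType) (Q : probability T R).
Local Open Scope ereal_scope.

Lemma measure_partition (kappa : T -> nat) (B : set T) :
  measurable_fun setT kappa -> measurable B ->
  Q B = \sum_(0 <= k <oo) Q (B `&` kappa @^-1` [set k]).
Proof.
move=> mk mB; rewrite -[in LHS](bigcup_fibers kappa B).
rewrite measure_bigcup //; last exact: fibers_trivIset.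
  by apply: eq_eseriesl => k; rewrite in_setT.
by move=> k _; apply: measurableI => //; exact: measurable_nat_fiber.
Qed.

Lemma ge0_integral_countable (kappa : T -> nat) (B : set T) (G : nat -> R) :
  measurable_fun setT kappa -> measurable B -> (forall k, (0 <= G k)%R) ->
  \int[Q]_(w in B) (G (kappa w))%:E =
  \sum_(0 <= k <oo) (G k)%:E * Q (B `&` kappa @^-1` [set k]).
Proof.
move=> mk mB G0; rewrite (ge0_integral_partition Q mk) //; last first.
- by move=> w; rewrite lee_fin.
- apply: measurable_funTS; apply/measurable_EFinP.
  by apply: (@measurable_nat_pick _ _ _ _ kappa (fun k _ => G k)).
apply: eq_eseriesr => k _; rewrite -integral_cst; last first.
  by apply: measurableI => //; exact: measurable_nat_fiber.
by apply: eq_integral => w; rewrite inE => -[_ /= ->].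
Qed.

End probability_partition.

Section poisson_mean.
Context d (T : measurableType d) (R : realType) (P : probability T R).
Variables (X : T -> nat) (mu : R).
Hypotheses (mX : measurable_fun setT X) (mu0 : 0 < mu).
Hypothesis X_poisson : forall k, P (X @^-1` [set k]) = (poisson_pmf mu k)%:E.
Local Open Scope ereal_scope.

Lemma poisson_pmf_mean : \sum_(0 <= k <oo) (k%:R * poisson_pmf mu k)%:E = mu%:E.
Proof.
have sum1 : \sum_(0 <= k <oo) (poisson_pmf mu k)%:E = 1.
  rewrite -(@probability_setT _ _ _ P) (measure_partition P mX) //.
  by apply: eq_eseriesr => k _; rewrite setTI X_poisson.
rewrite nneseries_recl //; last first.
  by move=> k _; rewrite lee_fin mulr_ge0 // poisson_pmf_ge0.
rewrite mul0r add0e -(nneseries_addn 1); last first.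
  by move=> k; rewrite lee_fin mulr_ge0 // poisson_pmf_ge0.
rewrite (@eq_eseriesr _ _ (fun k => mu%:E * (poisson_pmf mu k)%:E)); last first.
  move=> k _; rewrite addn1 -EFinM; congr EFin.
  rewrite /poisson_pmf mu0 factS natrM invfM exprS.
  have k0 : (k.+1%:R != 0 :> R)%R by rewrite pnatr_eq0.
  have f0 : (k`!%:R != 0 :> R)%R by rewrite pnatr_eq0 -lt0n fact_gt0.
  move: (k.+1%:R : R) (k`!%:R : R) k0 f0 => a b a0 b0.
  by field; rewrite a0 b0.
rewrite nneseriesZl ?sum1 ?mule1 // => k _.
by rewrite lee_fin poisson_pmf_ge0.
Qed.

Lemma integral_poisson (B : set T) : measurable B ->
  (forall k, P (B `&` X @^-1` [set k]) = P B * P (X @^-1` [set k])) ->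
  \int[P]_(w in B) (X w)%:R%:E = P B * mu%:E.
Proof.
move=> mB indep; rewrite (@ge0_integral_countable _ _ _ P X B (fun k => k%:R)) //.
rewrite -poisson_pmf_mean -[P B]fineK ?fin_num_measure //.
rewrite -nneseriesZl; last first.
  by move=> k _; rewrite lee_fin mulr_ge0 // poisson_pmf_ge0.
apply: eq_eseriesr => k _; rewrite indep X_poisson fineK ?fin_num_measure //.
by rewrite EFinM muleCA.
Qed.

End poisson_mean.

Section service_mean.
Context d (T : measurableType d) (R : realType) (P : probability T R).
Variables (lambda : R) (S r : T -> R) (N : R -> T -> nat) (rho : R -> R).
Hypotheses (lambda0 : 0 < lambda) (N_poisson : poisson_process P lambda N).
Hypotheses (mS : measurable_fun setT S) (S0 : forall w, 0 <= S w).
Hypotheses (mr : measurable_fun setT r) (r0 : forall w, 0 <= r w).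
Hypothesis indep : forall (X Y : set R) (C : set T),
  measurable X -> measurable Y ->
  generated_sigma [set t : R | 0 <= t] N C ->
  P (S @^-1` X `&` (r @^-1` Y `&` C)) =
  (P (S @^-1` X) * P (r @^-1` Y) * P C)%E.

Let mN t : 0 <= t -> measurable_fun setT (N t).
Proof. exact: poisson_measurable N_poisson t. Qed.

Let N_homo w s t : 0 <= s -> s <= t -> (N s w <= N t w)%N.
Proof. exact: poisson_nondecreasing N_poisson w s t. Qed.

Let N_rc w t : 0 <= t -> \forall s \near t^'+, N s w = N t w.
Proof. exact: poisson_right_continuous N_poisson w t. Qed.

Let generated_count t k :
  0 <= t -> generated_sigma [set t : R | 0 <= t] N (N t @^-1` [set k]).
Proof.
move=> t0; apply: sub_sigma_algebra; exists t => //.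
by exists [set k] => //; rewrite setTI.
Qed.

(** On each of the countably many values of tau (iota S) the time is fixed and
    the count is an independent Poisson variable. *)
Lemma mean_count_discrete (iota : R -> nat) (tau : nat -> R) :
  measurable_fun setT iota -> (forall k, 0 < tau k) ->
  (\int[P]_w (N (tau (iota (S w))) w)%:R%:E =
   \int[P]_w (lambda * tau (iota (S w)))%:E)%E.
Proof.
move=> miota tau0.
have mk : measurable_fun setT (iota \o S) by exact: measurableT_comp.
have mN' : measurable_fun setT (fun w => N (tau (iota (S w))) w).
  apply: (@measurable_nat_pick _ _ _ _ (iota \o S) (fun k => N (tau k))) => // k.
  by apply: mN; exact: ltW.
rewrite (ge0_integral_partition P mk) //; last first.
  apply/measurable_EFinP; apply: measurableT_comp mN' => //.
rewrite (@ge0_integral_countable _ _ _ P (iota \o S) setT (fun k => lambda * tau k)) //;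
  last by move=> k; rewrite mulr_ge0 // ltW.
apply: eq_eseriesr => k _; rewrite setTI.
have mB : measurable ((iota \o S) @^-1` [set k]) by exact: measurable_nat_fiber.
transitivity (\int[P]_(w in (iota \o S) @^-1` [set k]) (N (tau k) w)%:R%:E)%E.
  by apply: eq_integral => w; rewrite inE /= => ->.
rewrite (@integral_poisson _ _ _ P (N (tau k)) (lambda * tau k)).
- by rewrite muleC.
- by apply: mN; exact: ltW.
- by rewrite mulr_gt0.
- move=> j; have := poisson_increments N_poisson j (lexx 0) (tau0 k).
  rewrite subr0 => <-; congr (P _); apply/seteqP.
  by split=> w /=; rewrite (poisson_start N_poisson) subn0.
- exact: mB.
- move=> j; have := @indep (iota @^-1` [set k]) setT (N (tau k) @^-1` [set j]).
  rewrite preimage_setT setTI probability_setT mule1; apply => //.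
    exact: measurable_nat_fiber.
  by apply: generated_count; exact: ltW.
Qed.

Section integrable_service.
Hypothesis Si : P.-integrable setT (EFin \o S).

Let grid_le m w : grid_above m (S w) <= S w + 1.
Proof.
apply: le_trans (grid_above_le m (S0 w)) _; rewrite lerD2l.
by rewrite invf_le1 ?ltr0n // ler1n.
Qed.

Let grid_ge0 m (x : R) : 0 <= grid_above m x.
Proof. exact: ltW (grid_point_gt0 _ _ _). Qed.

Let integrable_shift (c : R) : P.-integrable setT (EFin \o (fun w => S w + c)).
Proof.
exact: (integrableD measurableT Si (finite_measure_integrable_cst P c measurableT)).
Qed.

Let measurable_count (s : T -> R) :
  measurable_fun setT s -> (forall w, 0 <= s w) ->
  measurable_fun setT (fun w => (N (s w) w)%:R : R).
Proof.
by move=> ms s0; apply: measurable_natr; exact: measurable_count_at.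
Qed.

(** Any time up to S + 1 lies below this grid time, and the mean of the count at
    it is finite by the discrete computation. *)
Let majorant w : R := (N (grid_above 0 (S w) + 1) w)%:R.

Let integrable_majorant : P.-integrable setT (EFin \o majorant).
Proof.
apply/integrableP; split.
  apply/measurable_EFinP; apply: measurable_count.
    by apply: measurable_funD; [exact: measurable_grid_above|exact: measurable_cst].
  by move=> w; rewrite addr_ge0.
under eq_integral => w _ do rewrite /= ger0_norm ?ler0n //.
rewrite (@mean_count_discrete (@grid_index R 0) (fun k => grid_point R 0 k + 1)).
- have : P.-integrable setT (EFin \o (fun w => lambda * (S w + 2))).
    exact: (integrableZl measurableT lambda (integrable_shift 2)).
  move=> /integrableP[_]; apply: le_lt_trans; apply: ge0_le_integral => //.
  + by move=> w _; rewrite lee_fin mulr_ge0 ?ltW // addr_gt0 // grid_point_gt0.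
  + apply/measurable_EFinP; apply: measurable_funM; first exact: measurable_cst.
    by apply: measurable_funD; [exact: measurable_grid_above|exact: measurable_cst].
  + apply/measurable_EFinP; apply: measurableT_comp => //.
    apply: measurable_funM; first exact: measurable_cst.
    by apply: measurable_funD => //; exact: measurable_cst.
  + move=> w _; rewrite /= lee_fin; apply: le_trans (ler_norm _).
    apply: ler_wpM2l; first exact: ltW.
    by have := grid_le 0 w; rewrite /grid_above; lra.
- exact: measurable_grid_index.
- by move=> k; rewrite addr_gt0 // grid_point_gt0.
Qed.

Let count_le_majorant (s : T -> R) w : 0 <= s w -> s w <= S w + 1 ->
  `|(N (s w) w)%:R : R| <= majorant w.
Proof.
move=> s0 sS; rewrite ger0_norm // ler_nat N_homo //.
by apply: le_trans sS _; rewrite lerD2r; exact: ltW (grid_above_gt _ _).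
Qed.

Lemma integrable_count : P.-integrable setT (EFin \o (fun w => (N (S w) w)%:R)).
Proof.
apply: le_integrable integrable_majorant => //.
  by apply/measurable_EFinP; exact: measurable_count.
move=> w _; rewrite /= lee_fin; apply: le_trans (ler_norm _).
by apply: count_le_majorant => //; rewrite lerDl.
Qed.

Lemma mean_count : \int[P]_w (N (S w) w)%:R = lambda * \int[P]_w S w.
Proof.
have c1 : \int[P]_w (N (grid_above m (S w)) w)%:R @[m --> \oo] -->
    \int[P]_w (N (S w) w)%:R.
  apply: (Rdominated_convergence (g := majorant)) => //.
  - by move=> m; apply: measurable_count => //; exact: measurable_grid_above.
  - exact: measurable_count.
  - apply: aeW => w _; apply: cvg_near_cst.
    by apply: filterS (count_grid_eventually N_rc (S0 w)) => m ->.
  - by move=> m; apply: aeW => w _;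
      exact: (@count_le_majorant (fun w => grid_above m (S w))).
have c2 : \int[P]_w (lambda * grid_above m (S w)) @[m --> \oo] -->
    \int[P]_w (lambda * S w).
  apply: (Rdominated_convergence (g := fun w => lambda * (S w + 1))) => //.
  - move=> m; apply: measurable_funM; first exact: measurable_cst.
    exact: measurable_grid_above.
  - by apply: measurable_funM => //; exact: measurable_cst.
  - by apply: aeW => w _; apply: cvgMr; exact: grid_above_cvg.
  - exact: (integrableZl measurableT lambda (integrable_shift 1)).
  - move=> m; apply: aeW => w _; rewrite ger0_norm.
      by apply: ler_wpM2l => //; exact: ltW.
    by apply: mulr_ge0; [exact: ltW|exact: grid_ge0].
have e m : \int[P]_w (N (grid_above m (S w)) w)%:R =
    \int[P]_w (lambda * grid_above m (S w)).
  congr fine; apply: (@mean_count_discrete (@grid_index R m) (grid_point R m)).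
    exact: measurable_grid_index.
  by move=> k; exact: grid_point_gt0.
rewrite (_ : (fun m => _) = (fun m => \int[P]_w (lambda * grid_above m (S w)))) in c1;
  last by apply/funext.
rewrite (cvg_unique _ c1 c2) // RintegralZl //.
Qed.

End integrable_service.

Section no_arrival.
Hypotheses (mrho : measurable_fun setT rho) (rho0 : forall x, 0 <= rho x).
Hypothesis r_density : forall A : set R, measurable A ->
  P (r @^-1` A) = (\int[lebesgue_measure]_(x in A) (rho x)%:E)%E.

Let D : set R := [set` `[0%R, +oo[].

Let mD : measurable D. Proof. exact: measurable_itv. Qed.

Let generated_no_arrival u v : 0 <= u -> 0 <= v ->
  generated_sigma [set t : R | 0 <= t] N [set w | N v w = N u w].
Proof.
move=> u0 v0; rewrite /generated_sigma; set G := (X in <<s X >>).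
have -> : [set w | N v w = N u w] =
    \bigcup_k (N u @^-1` [set k] `&` N v @^-1` [set k]).
  by apply/seteqP; split=> w /=; [move=> h; exists (N u w) | move=> [k _ [/= -> ->]]].
apply: (@bigcupT_measurable _ (g_sigma_algebraType G)) => k.
by apply: (@measurableI _ (g_sigma_algebraType G)); exact: generated_count.
Qed.

Let no_arrival_increment u v : 0 <= u -> u < v ->
  P [set w | N v w = N u w] = (expR (- (lambda * (v - u))))%:E.
Proof.
move=> u0 uv; rewrite (_ : [set _ | _] = [set w | (N v w - N u w)%N = 0%N]).
  rewrite (poisson_increments N_poisson) // /poisson_pmf mulr_gt0 ?subr_gt0 //.
  by rewrite expr0 fact0 invr1 !mul1r.
have h w := N_homo w u0 (ltW uv).
by apply/seteqP; split=> w /= e; move: (h w) e; lia.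
Qed.

Let E m : set T := [set w |
  N (grid_above m (S w) + grid_above m (r w)) w = N (grid_above m (S w)) w].

Let grid_gt0 m x : 0 < grid_above m x :> R. Proof. exact: grid_point_gt0. Qed.

Let measurable_eq_count (s t : T -> R) :
  measurable_fun setT s -> measurable_fun setT t ->
  (forall w, 0 <= s w) -> (forall w, 0 <= t w) ->
  measurable [set w | N (t w) w = N (s w) w].
Proof.
move=> ms mt s0 t0.
have -> : [set w | N (t w) w = N (s w) w] =
    \bigcup_k ((fun w => N (s w) w) @^-1` [set k] `&`
               (fun w => N (t w) w) @^-1` [set k]).
  by apply/seteqP; split=> w /=; [move=> h; exists (N (s w) w) | move=> [k _ [/= -> ->]]].
apply: bigcupT_measurable => k.
by apply: measurableI; apply: measurable_nat_fiber; exact: measurable_count_at.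
Qed.

Let mE m : measurable (E m).
Proof.
apply: measurable_eq_count.
- exact: measurable_grid_above.
- by apply: measurable_funD; exact: measurable_grid_above.
- by move=> w; exact: ltW.
- by move=> w; rewrite addr_ge0 // ltW.
Qed.

(** Splitting over the grid indices l of r and k of S gives the sum of
    P(index r = l) P(index S = k) exp(- lambda t_l).  The sum over k is 1; the
    density of r turns the sum over l into the integral. *)
Let prob_grid m : P (E m) =
  (\int[lebesgue_measure]_(x in D) (expR (- (lambda * grid_above m x)) * rho x)%:E)%E.
Proof.
have mi := @measurable_grid_index R m.
have mk : measurable_fun setT (grid_index m \o S) by exact: measurableT_comp.
have ml : measurable_fun setT (grid_index m \o r) by exact: measurableT_comp.
rewrite (measure_partition P ml) // (@ge0_integral_partition _ _ R
  (@lebesgue_measure R) (grid_index m) D) //.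
- apply: eq_eseriesr => l _.
  set e := expR (- (lambda * grid_point R m l)).
  transitivity (e%:E * P ((grid_index m \o r) @^-1` [set l]))%E.
    rewrite (measure_partition P mk) //; last first.
      by apply: measurableI => //; exact: measurable_nat_fiber.
    rewrite (@eq_eseriesr _ _ (fun k => (e%:E * P ((grid_index m \o r) @^-1` [set l])) *
        P (setT `&` (grid_index m \o S) @^-1` [set k]))%E); last first.
      move=> k _; rewrite setTI.
      set u := grid_point R m k; set v := u + grid_point R m l.
      have u0 : 0 <= u by exact: ltW (grid_point_gt0 _ _ _).
      have uv : u < v by rewrite ltrDl grid_point_gt0.
      have -> : E m `&` (grid_index m \o r) @^-1` [set l]
          `&` (grid_index m \o S) @^-1` [set k] =
          S @^-1` (grid_index m @^-1` [set k]) `&`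
          (r @^-1` (grid_index m @^-1` [set l]) `&` [set w | N v w = N u w]).
        apply/seteqP; split=> w /=; rewrite /E /grid_above /v /u /=.
          by move=> [[h <-] <-].
        by move=> [ek [el h]]; rewrite ek el.
      rewrite indep; [|exact: measurable_nat_fiber|exact: measurable_nat_fiber|].
        rewrite no_arrival_increment // /v addrAC subrr add0r -/e.
        by rewrite muleC [X in (_ * X)%E]muleC muleA.
      by apply: generated_no_arrival => //; exact: le_trans u0 (ltW uv).
    have ef : (e%:E * P ((grid_index m \o r) @^-1` [set l]))%E \is a fin_num.
      rewrite fin_numM // fin_num_measure //; exact: measurable_nat_fiber.
    rewrite -(fineK ef) nneseriesZl; last by move=> k _; exact: measure_ge0.
    by rewrite -(measure_partition P mk) // probability_setT mule1.
  have -> : (grid_index m \o r) @^-1` [set l] =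
      r @^-1` (D `&` grid_index m @^-1` [set l]).
    apply/seteqP; split=> w /=; last by case.
    by move=> h; split=> //; rewrite /D /= in_itv /= andbT.
  have mDl : measurable (D `&` grid_index m @^-1` [set l]).
    by apply: measurableI => //; exact: measurable_nat_fiber.
  rewrite r_density // -ge0_integralZl_EFin //; last 3 first.
  + by move=> x _; rewrite lee_fin.
  + by apply/measurable_EFinP; exact: measurable_funTS.
  + exact: expR_ge0.
  by apply: eq_integral => x; rewrite inE => -[_ /= h]; rewrite /e /grid_above h EFinM.
- apply/measurable_EFinP; apply: measurable_funTS; apply: measurable_funM => //.
  apply: (@measurable_nat_pick _ _ _ _ (grid_index m)
    (fun k _ => expR (- (lambda * grid_point R m k)))) => //.
- by move=> x; rewrite lee_fin mulr_ge0 // expR_ge0.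
Qed.

Lemma prob_no_arrival :
  P [set w | N (S w + r w) w = N (S w) w] = laplace_transform rho lambda.
Proof.
set F := [set w | _].
have mF : measurable F.
  apply: measurable_eq_count => //; first exact: measurable_funD.
  by move=> w; rewrite addr_ge0.
have rhoi : lebesgue_measure.-integrable D (EFin \o rho).
  apply: (integrableS measurableT) => //.
  apply/integrableP; split; first exact/measurable_EFinP.
  under eq_integral => x _ do rewrite /= ger0_norm //.
  by rewrite -r_density // preimage_setT probability_setT ltry.
have mexp (c : R -> R) : measurable_fun setT c ->
    measurable_fun D (fun x => expR (- (lambda * c x)) * rho x).
  move=> mc; apply: measurable_funTS; apply: measurable_funM => //.
  apply: measurableT_comp => //; apply: measurableT_comp => //.
  exact: measurable_funM.
have bexp (c x : R) : 0 <= c -> `|expR (- (lambda * c)) * rho x| <= rho x.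
  move=> c0; rewrite ger0_norm ?mulr_ge0 ?expR_ge0 // ler_piMl //.
  by rewrite -expR0 ler_expR oppr_le0 mulr_ge0 // ltW.
have mgrid m : measurable_fun setT (@grid_above R m).
  exact: (@measurable_grid_above _ _ _ id m).
have expi (c : R -> R) : measurable_fun setT c -> (forall x, D x -> 0 <= c x) ->
    lebesgue_measure.-integrable D
      (EFin \o (fun x => expR (- (lambda * c x)) * rho x)).
  move=> mc c0; apply: le_integrable rhoi => //.
    by apply/measurable_EFinP; exact: mexp.
  move=> x Dx; rewrite /= lee_fin; apply: le_trans (ler_norm _).
  by apply: bexp; exact: c0.
have c1 : \int[P]_w \1_(E m) w @[m --> \oo] --> (\int[P]_w \1_F w : R).
  apply: (@Rdominated_convergence _ _ _ _ _ _ _ (fun=> 1)).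
  - exact: measurableT.
  - by move=> m; exact: measurable_indic.
  - exact: measurable_indic.
  - apply: aeW => w _; apply: cvg_near_cst.
    have h1 := count_grid_eventually N_rc (S0 w).
    have h2 : \forall m \near \oo,
        N (grid_above m (S w) + grid_above m (r w)) w = N (S w + r w) w.
      apply: (@right_continuous_eventually _ (N ^~ w) (S w + r w)
        (fun m => grid_above m (S w) + grid_above m (r w))).
      + by apply: N_rc; rewrite addr_ge0.
      + by move=> m; rewrite ltrD // grid_above_gt.
      + by apply: cvgD; exact: grid_above_cvg.
    apply: filterS2 h1 h2 => m e1 e2; rewrite !indicE.
    rewrite (_ : (w \in E m) = (w \in F)) //.
    by apply: asbool_equiv_eq; rewrite /E /F /= e1 e2.
  - exact: (finite_measure_integrable_cst P 1 measurableT).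
  - move=> m; apply: aeW => w _; rewrite indicE.
    by case: (w \in E m); rewrite ?normr1 ?normr0.
have c2 : (\int[lebesgue_measure]_(x in D) (expR (- (lambda * grid_above m x)) * rho x))
    @[m --> \oo] -->
    (\int[lebesgue_measure]_(x in D) (expR (- (lambda * x)) * rho x)).
  apply: (@Rdominated_convergence _ _ R (@lebesgue_measure R) D
    (fun m x => expR (- (lambda * grid_above m x)) * rho x)
    (fun x => expR (- (lambda * x)) * rho x) rho).
  - exact: mD.
  - by move=> m; exact: mexp.
  - exact: (mexp id).
  - apply: aeW => x; rewrite /D /= in_itv /= andbT => x0.
    apply: cvgMl; apply: continuous_cvg; first exact: continuous_expR.
    by apply: cvgN; apply: cvgMr; exact: grid_above_cvg.
  - exact: rhoi.
  - by move=> m; apply: aeW => x _; apply: bexp; exact: ltW.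
rewrite (_ : (fun m => _) = (fun m => \int[lebesgue_measure]_(x in D)
    (expR (- (lambda * grid_above m x)) * rho x))) in c1; last first.
  by apply/funext => m; rewrite Rintegral_setT_indic // prob_grid.
have := cvg_unique _ c1 c2; rewrite Rintegral_setT_indic // => h.
rewrite -[LHS]fineK ?fin_num_measure // (h _) // /Rintegral fineK //.
apply: (@integrable_fin_num _ _ R (@lebesgue_measure R) D mD).
apply: (expi id) => // x.
by rewrite /D /= in_itv /= andbT.
Qed.

End no_arrival.

End service_mean.

(** * The increments of the queue *)
Section generated.
Context d (T : measurableType d).

Lemma generated_sigma_sub d' (V : measurableType d') (I : Type) (D : set I)
    (X : I -> T -> V) : (forall i, D i -> measurable_fun setT (X i)) ->
  generated_sigma D X `<=` measurable.
Proof.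
move=> mX; apply: smallest_sub; first exact: sigma_algebra_measurable.
by move=> _ [i Di [B mB <-]]; exact: mX.
Qed.

Lemma generated_sigma_fun d' (V : measurableType d') (I : Type) (D : set I)
    (X : I -> T -> V) (G : set (set T)) i :
  generated_sigma D X `<=` <<s G >> -> D i ->
  measurable_fun (setT : set (g_sigma_algebraType G))
    (X i : g_sigma_algebraType G -> V).
Proof.
move=> XG Di _ B mB; apply: XG; apply: sub_sigma_algebra.
by exists i => //; exists B.
Qed.

Lemma preimage_generated_sigma d' (V : measurableType d') (I J : Type)
    (D : set I) (X : I -> T -> V) (D' : set J) (X' : J -> T -> V) (h : T -> T) :
  (forall i, D i -> exists2 j, D' j & X i \o h = X' j) ->
  forall A, generated_sigma D X A -> generated_sigma D' X' (h @^-1` A).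
Proof.
move=> Xh; pose G' := \bigcup_(j in D') preimage_set_system setT (X' j) measurable.
have : sigma_algebra setT [set A | <<s G' >> (h @^-1` A)].
  split => /=.
  - by rewrite preimage_set0; exact: (@measurable0 _ (g_sigma_algebraType G')).
  - move=> A hA; rewrite setTD preimage_setC.
    exact: (@measurableC _ (g_sigma_algebraType G')).
  - move=> F hF; rewrite preimage_bigcup.
    by apply: (@bigcupT_measurable _ (g_sigma_algebraType G')).
move=> /smallest_sub h1; apply: h1.
move=> _ [i Di [B mB <-]] /=; rewrite setTI; apply: sub_sigma_algebra.
have [j D'j Xj] := Xh _ Di; exists j => //; exists B => //.
by rewrite setTI -Xj.
Qed.

End generated.

Section queue.
Context d (T : measurableType d) (R : realType) (P : probability T R).
Variables (theta : int -> T -> T) (lambda : R).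
Variables (sigma r : int -> T -> R) (N : int -> R -> T -> nat) (rho : R -> R).
Hypothesis hqueue : control_retrial_queue P sigma r N theta lambda rho.

Let flow := queue_flow hqueue.

Lemma theta_shift (V : Type) (X : int -> T -> V) :
  shift_sequence theta X -> forall n k w, X k (theta n w) = X (k + n) w.
Proof. by move=> sX n k w; rewrite -sX. Qed.

Let thetaD m n w : theta (m + n) w = theta m (theta n w) := flowD flow m n w.

Let theta0 w : theta 0 w = w := flow0 flow w.

Lemma iter_theta1 n w : iter n (theta 1) w = theta n%:Z w.
Proof.
elim: n => [|n IHn]; first by rewrite theta0.
by rewrite iterS IHn -thetaD -intS.
Qed.

Lemma iter_thetaN1 n w : iter n (theta (-1)) w = theta (- n%:Z) w.
Proof.
elim: n => [|n IHn]; first by rewrite oppr0 theta0.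
by rewrite iterS IHn -thetaD intS opprD.
Qed.

Let mtheta n : measurable_fun setT (theta n) := flow_measurable flow n.

Let thetaP n A : measurable A -> P (theta n @^-1` A) = P A.
Proof. exact: flow_preserves flow n A. Qed.

Lemma xiE n w : xi sigma r N n w =
  (N n (sigma n w) w)%:Z - ((N n (sigma n w + r n w) w == N n (sigma n w) w) : nat)%:Z.
Proof.
rewrite /xi /residual_arrival_time (@no_arrival_before _ (fun t => N n t w)) //.
- exact: poisson_nondecreasing (arrival_poisson hqueue n) w.
- exact: poisson_right_continuous (arrival_poisson hqueue n) w.
- exact: service_ge0 hqueue n w.
- exact: retrial_ge0 hqueue n w.
Qed.

Lemma xi_shift n k w : xi sigma r N n (theta k w) = xi sigma r N (n + k) w.
Proof.
have Nk t : 0 <= t -> N n t (theta k w) = N (n + k) t w.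
  by move=> t0; rewrite (theta_shift (arrival_shift hqueue t0)).
rewrite !xiE (theta_shift (service_shift hqueue)) (theta_shift (retrial_shift hqueue)).
have s0 := service_ge0 hqueue (n + k) w; have r0 := retrial_ge0 hqueue (n + k) w.
by rewrite !Nk // addr_ge0.
Qed.

(** The generated sigma-algebra consists of the events of the whole driving
    sequence; the increments and the stationary orbit are measurable for it. *)
Definition queue_events : set (set T) := \bigcup_i driving_sigma sigma r N i.

Lemma driving_sigma_algebra i : sigma_algebra setT (driving_sigma sigma r N i).
Proof. by case: i => [[n|n]|]; exact: smallest_sigma_algebra. Qed.

Lemma driving_sigma_measurable i : driving_sigma sigma r N i `<=` measurable.
Proof.
case: i => [[n|n]|]; apply: generated_sigma_sub.
- by move=> ? _; exact: retrial_measurable hqueue n.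
- by move=> t t0; exact: (poisson_measurable (arrival_poisson hqueue n)).
- by move=> n _; exact: service_measurable hqueue n.
Qed.

Lemma queue_events_measurable : queue_events `<=` measurable.
Proof. by move=> A [i _]; exact: driving_sigma_measurable. Qed.

Lemma queue_sigma_measurable : <<s queue_events >> `<=` measurable.
Proof.
apply: smallest_sub queue_events_measurable; exact: sigma_algebra_measurable.
Qed.

Definition shift_index (k : int) (j : int + int) : int + int :=
  match j with inl n => inl (n + k) | inr n => inr (n + k) end.

Lemma driving_sigma_shift k i A : driving_sigma sigma r N i A ->
  driving_sigma sigma r N (omap (shift_index k) i) (theta k @^-1` A).
Proof.
case: i => [[n|n]|] /=; apply: preimage_generated_sigma.
- move=> [] _; exists tt => //.
  by apply/funext => w; rewrite /= (theta_shift (retrial_shift hqueue)).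
- move=> t t0; exists t => //.
  by apply/funext => w; rewrite /= (theta_shift (arrival_shift hqueue t0)).
- move=> n _; exists (n + k) => //.
  by apply/funext => w; rewrite /= (theta_shift (service_shift hqueue)).
Qed.

Lemma measurable_theta_queue k :
  measurable_fun (setT : set (g_sigma_algebraType queue_events))
    (theta k : g_sigma_algebraType queue_events -> g_sigma_algebraType queue_events).
Proof.
apply: (@measurability _ _ (g_sigma_algebraType queue_events)
  (g_sigma_algebraType queue_events) setT (theta k) queue_events) => //.
move=> _ [A [i _ hA] <-]; rewrite setTI; apply: sub_sigma_algebra.
by exists (omap (shift_index k) i) => //; exact: driving_sigma_shift.
Qed.

Lemma zero_one_queue : zero_one P (theta 1) <<s queue_events >>.
Proof.
apply: (@zero_one_independent_extension _ _ _ P _ (driving_sigma sigma r N) (shift_index 1)).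
- exact: mtheta.
- exact: thetaP.
- exact: driving_sigma_algebra.
- exact: driving_sigma_measurable.
- exact: queue_independent hqueue.
- by move=> A; exact: (@driving_sigma_shift 1 None).
- by move=> j A; exact: (@driving_sigma_shift 1 (Some j)).
- by move=> [m|m] [n|n] //= [/addIr ->].
- have it n j : iter n (shift_index 1) j = shift_index n%:Z j.
    elim: n => [|n IHn]; first by case: j => m /=; rewrite addr0.
    by rewrite iterS IHn; case: (j) => m /=; rewrite -addrA intS (addrC 1).
  move=> i j; case: i => m; case: j => n.
  + exists (absz (n - m)).+1 => k hk; rewrite it /=.
    by apply/eqP => -[]; lia.
  + by exists 0%N => k _; rewrite it.
  + by exists 0%N => k _; rewrite it.
  + exists (absz (n - m)).+1 => k hk; rewrite it /=.
    by apply/eqP => -[]; lia.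
- exact: service_ergodic hqueue.
Qed.

(** Events invariant under the backward shift are those invariant under the
    forward shift; the backward shift carries the construction from the past. *)
Lemma zero_one_queueN : zero_one P (theta (-1)) <<s queue_events >>.
Proof.
move=> A GA Ainv; apply: zero_one_queue => //.
rewrite -[in LHS]Ainv; apply/seteqP; split=> w; rewrite /preimage /= -thetaD addNr theta0 //.
Qed.

Lemma service_retrial_arrival_independent n (X Y : set R) (C : set T) :
  measurable X -> measurable Y -> generated_sigma [set t : R | 0 <= t] (N n) C ->
  P (sigma n @^-1` X `&` (r n @^-1` Y `&` C)) =
  (P (sigma n @^-1` X) * P (r n @^-1` Y) * P C)%E.
Proof.
move=> mX mY hC.
pose E (i : option (int + int)) := match i with
  | None => sigma n @^-1` X | Some (inl _) => r n @^-1` Y | Some (inr _) => C end.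
pose J : seq (option (int + int)) := [:: None; Some (inl n); Some (inr n)].
have := queue_independent hqueue (J := J) (E := E).
rewrite /J !big_cons !big_nil /= setIT mule1 muleA; apply => //.
move=> i; rewrite !inE => /or3P[] /eqP-> //=; apply: sub_sigma_algebra.
- by exists n => //; exists X => //; rewrite setTI.
- by exists tt => //; exists Y => //; rewrite setTI.
Qed.

Definition xi_real (n : int) (w : T) : R := (xi sigma r N n w)%:~R.

Let no_arrival_event n := [set w | N n (sigma n w + r n w) w = N n (sigma n w) w].

Let xi_realE n w :
  xi_real n w = (N n (sigma n w) w)%:R - \1_(no_arrival_event n) w.
Proof.
rewrite /xi_real xiE intrD mulrNz indicE; congr (_ - _%:R).
by congr nat_of_bool; apply/eqP/idP; rewrite inE.
Qed.

(** Stated for an arbitrary measurable space, to be used with the sigma-algebra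
    of the driving sequence in place of that of the underlying space. *)
Lemma measurable_xi_pair d' (T' : measurableType d') d2 (V : sigmaRingType d2)
    (S r' : T' -> R) (N' : R -> T' -> nat) (phi : nat -> nat -> V) :
  measurable_fun setT S -> measurable_fun setT r' ->
  (forall w, 0 <= S w) -> (forall w, 0 <= r' w) ->
  (forall t, 0 <= t -> measurable_fun setT (N' t)) ->
  (forall w t, 0 <= t -> \forall s \near t^'+, N' s w = N' t w) ->
  measurable_fun setT (fun w => phi (N' (S w) w) (N' (S w + r' w) w)).
Proof.
move=> mS mr S0 r0 mN Nrc.
apply: (@measurable_nat_pick _ _ _ _ (fun w => N' (S w) w)
  (fun k w => phi k (N' (S w + r' w) w))) => [|k].
  exact: measurable_count_at.
apply: (@measurable_nat_pick _ _ _ _ (fun w => N' (S w + r' w) w)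
  (fun l _ => phi k l)) => [|l]; last exact: measurable_cst.
apply: (measurable_count_at mN Nrc); first exact: measurable_funD.
by move=> w; rewrite addr_ge0.
Qed.

Lemma measurable_xi_queue n d2 (V : sigmaRingType d2) (psi : int -> V) :
  measurable_fun (setT : set (g_sigma_algebraType queue_events))
    ((fun w => psi (xi sigma r N n w)) : g_sigma_algebraType queue_events -> V).
Proof.
have gen i : driving_sigma sigma r N i `<=` <<s queue_events >>.
  by move=> A hA; apply: sub_sigma_algebra; exists i.
under eq_fun do rewrite xiE.
apply: (@measurable_xi_pair _ (g_sigma_algebraType queue_events) _ _ (sigma n) (r n)
  (N n) (fun a b => psi (a%:Z - ((b == a) : nat)%:Z))).
- exact: (generated_sigma_fun (gen None)).
- exact: (@generated_sigma_fun _ _ _ _ _ _ _ _ tt (gen (Some (inl n)))).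
- exact: service_ge0 hqueue n.
- exact: retrial_ge0 hqueue n.
- by move=> t t0; exact: (generated_sigma_fun (gen (Some (inr n)))).
- exact: poisson_right_continuous (arrival_poisson hqueue n).
Qed.

Lemma measurable_queue_fun d2 (V : sigmaRingType d2) (f : T -> V) :
  measurable_fun (setT : set (g_sigma_algebraType queue_events))
    (f : g_sigma_algebraType queue_events -> V) -> measurable_fun setT f.
Proof.
move=> mf _ B mB; apply: queue_sigma_measurable.
exact: (mf measurableT).
Qed.

Definition drift : R :=
  lambda * fine 'E_P[sigma 1] - fine (laplace_transform rho lambda).

Let mean_facts : [/\ P.-integrable setT (EFin \o xi_real 1),
  \int[P]_w xi_real 1 w = drift &
  (laplace_transform rho lambda) \is a fin_num].
Proof.
have N1 := arrival_poisson hqueue 1.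
have mS := service_measurable hqueue 1; have S0 := service_ge0 hqueue 1.
have mr := retrial_measurable hqueue 1; have r0 := retrial_ge0 hqueue 1.
have l0 := arrival_rate_gt0 hqueue.
have ind := @service_retrial_arrival_independent 1.
have Si := service_integrable hqueue.
have Ni := integrable_count l0 N1 mS S0 ind Si.
have mean := mean_count l0 N1 mS S0 ind Si.
have pF := prob_no_arrival l0 N1 mS S0 mr r0 ind (retrial_density_measurable hqueue)
  (retrial_density_ge0 hqueue) (retrial_density hqueue).
have mF : measurable (no_arrival_event 1).
  have := @measurable_xi_pair _ T _ bool (sigma 1) (r 1) (N 1) (fun a b => b == a)
    mS mr S0 r0 (poisson_measurable N1) (poisson_right_continuous N1).
  move=> /(_ measurableT [set true] I); rewrite setTI.
  by congr measurable; apply/seteqP; split=> w /= /eqP.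
have Fi : P.-integrable setT (EFin \o (\1_(no_arrival_event 1) : T -> R)).
  by apply: bounded_integrable => //; exact: bounded_measurable_indic.
have xiB : xi_real 1 = (fun w => (N 1 (sigma 1 w) w)%:R - \1_(no_arrival_event 1) w).
  by apply/funext => w; exact: xi_realE.
split.
- rewrite xiB; exact: (integrableB measurableT Ni Fi).
- rewrite xiB RintegralB // mean Rintegral_setT_indic // pF.
  by rewrite /drift unlock.
- by rewrite -pF fin_num_measure.
Qed.

Lemma xi_real_shift n k w : xi_real n (theta k w) = xi_real (n + k) w.
Proof. by rewrite /xi_real xi_shift. Qed.

Lemma integrable_xi n : P.-integrable setT (EFin \o xi_real n).
Proof.
have [h _ _] := mean_facts.
have := integrable_comp_preserving (@mtheta (n - 1)) (@thetaP (n - 1)) h.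
by congr (P.-integrable _ (EFin \o _)); apply/funext => w /=; rewrite xi_real_shift subrKC.
Qed.

Lemma mean_xi n : \int[P]_w xi_real n w = drift.
Proof.
have [h <- _] := mean_facts.
rewrite -(Rintegral_comp_preserving (@mtheta (n - 1)) (@thetaP (n - 1)) measurableT h).
by apply: eq_Rintegral => w _; rewrite xi_real_shift subrKC.
Qed.

Lemma laplace_fin_num : laplace_transform rho lambda \is a fin_num.
Proof. by have [] := mean_facts. Qed.

Lemma driftE : (drift%:E = lambda%:E * 'E_P[sigma 1] - laplace_transform rho lambda)%E.
Proof.
have [_ _ h] := mean_facts.
rewrite /drift EFinB EFinM !fineK //.
by rewrite unlock; exact: (integrable_fin_num measurableT (service_integrable hqueue)).
Qed.

Lemma orbit_stepE q x : (orbit_step q x)%:R = Num.max 0 (q%:R + x%:~R) :> R.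
Proof.
have -> : q%:R + x%:~R = (q%:Z + x)%:~R :> R by rewrite intrD.
rewrite /orbit_step; case: (leP 0 (q%:Z + x)) => h.
  by rewrite (max_idPr _) ?ler0z // natr_absz ger0_norm.
rewrite absz0 (max_idPl _) //.
by rewrite lerz0 ltW.
Qed.

Local Notation orbit := (orbit_size sigma r N).

Definition walk (n : nat) (w : T) : R := \sum_(i < n) xi_real i%:Z w.

Lemma orbit_size_max Q0 n w :
  (orbit Q0 n w)%:R =
  Num.max ((Q0 w)%:R + walk n w) (orbit (fun=> 0%N) n w)%:R :> R.
Proof.
elim: n => [|n IHn]; first by rewrite /walk big_ord0 addr0 /= (max_idPl _).
rewrite [LHS]orbit_stepE IHn [orbit (fun=> 0%N) n.+1 w]/= orbit_stepE.
rewrite /walk big_ord_recr /= addrA maxCA; congr (Num.max _ _).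
by rewrite -addr_maxl.
Qed.

Lemma walk_le_orbit_size Q0 n w : walk n w <= (orbit Q0 n w)%:R.
Proof. by rewrite orbit_size_max le_max lerDr ler0n. Qed.

(** Both have then merged with the orbit started empty. *)
Lemma orbit_size_coalesce Q1 Q2 n w :
  (Q1 w)%:R + walk n w <= 0 -> (Q2 w)%:R + walk n w <= 0 ->
  orbit Q1 n w = orbit Q2 n w.
Proof.
move=> h1 h2; apply/eqP; rewrite -(eqr_nat R) (orbit_size_max Q1) (orbit_size_max Q2).
by rewrite !(max_idPr _) // (le_trans _ (ler0n _ _)).
Qed.

Lemma orbit_size_cat Q0 m n w :
  orbit Q0 (m + n) w = orbit (fun=> orbit Q0 m w) n (theta m%:Z w).
Proof.
elim: n => [|n IHn]; first by rewrite addn0.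
by rewrite addnS /= IHn xi_shift addrC.
Qed.

(** Reading the increments backwards from time -1, the partial maxima are the
    sizes at time 0 of orbits that were empty at time -n. *)
Lemma loynes_orbit_size n w :
  loynes (theta (-1)) (xi_real (-1)) n w =
  (orbit (fun=> 0%N) n (theta (- n%:Z) w))%:R.
Proof.
elim: n w => [//|n IHn] w.
rewrite [LHS]/= IHn [orbit _ n.+1 _]/= orbit_stepE addrC -thetaD.
rewrite -/(xi_real n%:Z (theta (- n.+1%:Z) w)) xi_real_shift.
have -> : - n%:Z + -1 = - n.+1%:Z by lia.
by have -> : n%:Z - n.+1%:Z = -1 by lia.
Qed.

Lemma walk_forward n w : walk n w = \sum_(i < n) xi_real 0 (iter i (theta 1) w).
Proof. by apply: eq_bigr => i _; rewrite iter_theta1 xi_real_shift add0r. Qed.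

Lemma walk_backward n w :
  walk n (theta (- n%:Z) w) = \sum_(i < n) xi_real (-1) (iter i (theta (-1)) w).
Proof.
rewrite [RHS](reindex_inj rev_ord_inj) /=; apply: eq_bigr => i _.
rewrite iter_thetaN1 !xi_real_shift; congr (xi_real _ w).
by have := ltn_ord i; lia.
Qed.

(** The coefficient c is 1 to bound the walk from above and -1 to bound it from
    below; e is a linear correction leaving the mean negative. *)
Lemma loynes_xi_null (k n : int) (c e : R) : k = 1 \/ k = -1 ->
  c * drift + e < 0 ->
  P (loynes_unbounded (theta k) (fun w => c * xi_real n w + e)) = 0%E.
Proof.
move=> hk neg.
have fi : P.-integrable setT (EFin \o (fun w => c * xi_real n w + e)).
  apply: (integrableD measurableT (integrableZl measurableT c (integrable_xi n))
    (finite_measure_integrable_cst P e measurableT)).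
apply: loynes_unbounded_null => //.
- exact: thetaP.
- rewrite RintegralD //; last exact: (finite_measure_integrable_cst P e measurableT).
    by rewrite RintegralZl // ?mean_xi ?Rintegral_prob_cst //; exact: integrable_xi.
  exact: (integrableZl measurableT c (integrable_xi n)).
have mf := @measurable_xi_queue n _ R (fun x => c * x%:~R + e).
have GB : <<s queue_events >> (loynes_unbounded (theta k) (fun w => c * xi_real n w + e)).
  apply: (@measurable_loynes_unbounded _ (g_sigma_algebraType queue_events)) => //.
  exact: measurable_theta_queue.
by case: hk GB => -> GB; [apply: zero_one_queue GB _|apply: zero_one_queueN GB _];
  exact: loynes_unbounded_invariant.
Qed.

Lemma measurable_loynes_xi (k n : int) (c e : R) :
  measurable (loynes_unbounded (theta k) (fun w => c * xi_real n w + e)).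
Proof.
apply: measurable_loynes_unbounded => //.
apply: measurable_queue_fun.
exact: (@measurable_xi_queue n _ R (fun x => c * x%:~R + e)).
Qed.

Lemma walk_le_ae (e : R) : drift + e < 0 ->
  {ae P, forall w, exists K : R, forall n, walk n w + n%:R * e <= K}.
Proof.
move=> neg; have h := @loynes_xi_null 1 0 1 e (or_introl erefl).
rewrite mul1r in h; have := ae_not_null (measurable_loynes_xi _ _ _ _) (h neg).
apply: filterS => w nb; have [K hK] := loynes_boundedP nb; exists K%:R => n.
apply: le_trans (hK n); apply: le_trans (sum_le_loynes _ _ _ _).
rewrite big_split /= sumr_const card_ord mulr_natl lerD2r walk_forward.
by rewrite le_eqVlt; apply/orP; left; apply/eqP; apply: eq_bigr => i _; rewrite mul1r.
Qed.

Lemma walk_backward_le_ae (e : R) : drift + e < 0 ->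
  {ae P, forall w, exists K : R,
     forall n : nat, walk n (theta (- n%:Z) w) + n%:R * e <= K}.
Proof.
move=> neg; have h := @loynes_xi_null (-1) (-1) 1 e (or_intror erefl).
rewrite mul1r in h; have := ae_not_null (measurable_loynes_xi _ _ _ _) (h neg).
apply: filterS => w nb; have [K hK] := loynes_boundedP nb; exists K%:R => n.
apply: le_trans (hK n); apply: le_trans (sum_le_loynes _ _ _ _).
rewrite big_split /= sumr_const card_ord mulr_natl lerD2r walk_backward.
by rewrite le_eqVlt; apply/orP; left; apply/eqP; apply: eq_bigr => i _; rewrite mul1r.
Qed.

Lemma walk_cvg_pinfty_ae : 0 < drift ->
  {ae P, forall w, walk n w @[n --> \oo] --> +oo}.
Proof.
move=> pos; have h := @loynes_xi_null 1 0 (-1) (drift / 2) (or_introl erefl).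
have neg : -1 * drift + drift / 2 < 0 by lra.
have := ae_not_null (measurable_loynes_xi _ _ _ _) (h neg).
apply: filterS => w nb; have [K hK] := loynes_boundedP nb.
have low n : n%:R * (drift / 2) - K%:R <= walk n w.
  have := le_trans (sum_le_loynes _ _ n w) (hK n).
  rewrite big_split /= sumr_const card_ord walk_forward mulr_natl.
  have -> : \sum_(i < n) -1 * xi_real 0 (iter i (theta 1) w) =
      - \sum_(i < n) xi_real 0 (iter i (theta 1) w).
    by rewrite -sumrN; apply: eq_bigr => i _; rewrite mulN1r.
  by lra.
apply/cvgryPge => A.
exists (Num.truncn ((`|A| + K%:R) / (drift / 2))).+1 => // n /= hn.
apply: le_trans (low n); rewrite lerBrDr.
have d2 : 0 < drift / 2 by rewrite divr_gt0.
apply: (@le_trans _ _ (`|A| + K%:R)); first by rewrite lerD2r ler_norm.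
rewrite -ler_pdivrMr //; apply: le_trans (ltW (truncnS_gt _)) _.
by rewrite ler_nat.
Qed.

End queue.

(** * The stable queue *)
Lemma nondecreasing_bounded_nat (u : nat -> nat) (K : nat) :
  {homo u : m n / (m <= n)%N} -> (forall n, (u n <= K)%N) ->
  exists x, \forall n \near \oo, u n = x.
Proof.
move=> u_homo uK; have [m hm] : exists m, forall n, (u n <= u m)%N.
  have ex : exists k, `[< exists m, u m = k >] by exists (u 0%N); apply/asboolP; exists 0%N.
  have ub k : `[< exists m, u m = k >] -> (k <= K)%N by move=> /asboolP[m <-].
  case: (ex_maxnP ex ub) => _ /asboolP[m <-] h; exists m => n.
  by apply: h; apply/asboolP; exists n.
exists (u m); exists m => // n /= mn; apply/eqP.
by rewrite eqn_leq hm u_homo.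
Qed.

Section stable_queue.
Context d (T : measurableType d) (R : realType) (P : probability T R).
Variables (theta : int -> T -> T) (lambda : R).
Variables (sigma r : int -> T -> R) (N : int -> R -> T -> nat) (rho : R -> R).
Hypothesis hqueue : control_retrial_queue P sigma r N theta lambda rho.
Hypothesis drift_neg : drift P lambda sigma rho < 0.

Let flow := queue_flow hqueue.
Let thetaD m n w : theta (m + n) w = theta m (theta n w) := flowD flow m n w.
Let theta0 w : theta 0 w = w := flow0 flow w.
Let mtheta n : measurable_fun setT (theta n) := flow_measurable flow n.
Let thetaP n A : measurable A -> P (theta n @^-1` A) = P A.
Proof. exact: flow_preserves flow n A. Qed.

Local Notation orbit := (orbit_size sigma r N).
Local Notation xi_ := (xi sigma r N).

Definition orbit_from_past (n : nat) (w : T) : nat :=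
  orbit (fun=> 0%N) n (theta (- n%:Z) w).

Let unbounded : set T := loynes_unbounded (theta (-1)) (xi_real sigma r N (-1)).

Lemma orbit_from_past_homo w : {homo orbit_from_past^~ w : m n / (m <= n)%N}.
Proof.
move=> m n mn; rewrite -(ler_nat R) -!(loynes_orbit_size hqueue).
exact: loynes_homo.
Qed.

Lemma orbit_from_past_eventually w : ~ unbounded w ->
  exists x, \forall n \near \oo, orbit_from_past n w = x.
Proof.
move=> nb; have [K hK] := loynes_boundedP nb.
apply: (@nondecreasing_bounded_nat _ K); first exact: orbit_from_past_homo.
by move=> n; rewrite -(ler_nat R) -(loynes_orbit_size hqueue).
Qed.

Lemma orbit_from_past_step n w :
  orbit_from_past n.+1 (theta 1 w) = orbit_step (orbit_from_past n w) (xi_ 0 w).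
Proof.
rewrite /orbit_from_past /= -thetaD (_ : - n.+1%:Z + 1 = - n%:Z); last by lia.
by rewrite (xi_shift hqueue) subrr.
Qed.

(** The limit of the nondecreasing sizes [orbit_from_past n w], with the default
    value 0 where they are unbounded. *)
Definition stationary_orbit (w : T) : nat :=
  xget 0%N [set x | \forall n \near \oo, orbit_from_past n w = x].

Lemma stationary_orbitE w : ~ unbounded w ->
  \forall n \near \oo, orbit_from_past n w = stationary_orbit w.
Proof.
move=> /orbit_from_past_eventually[x hx].
exact: (@xgetI _ 0%N [set x | \forall n \near \oo, orbit_from_past n w = x] x hx).
Qed.

Let unbounded_theta n w : unbounded (theta n w) <-> unbounded w.
Proof.
have inv1 u : unbounded (theta (-1) u) <-> unbounded u.
  rewrite /unbounded -[X in _ <-> X _](loynes_unbounded_invariant (theta (-1))).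
  by [].
have inv k u : unbounded (theta (- k%:Z) u) <-> unbounded u.
  elim: k u => [|k IHk] u; first by rewrite oppr0 theta0.
  by rewrite intS opprD thetaD inv1 IHk.
case: n => k; last by rewrite NegzE; exact: inv.
by rewrite -[X in _ <-> unbounded X]theta0 -(addNr k%:Z) thetaD inv.
Qed.

Lemma stationary_orbit_step w : ~ unbounded w ->
  stationary_orbit (theta 1 w) = orbit_step (stationary_orbit w) (xi_ 0 w).
Proof.
move=> nb; have nb1 : ~ unbounded (theta 1 w) by rewrite unbounded_theta.
have [m1 _ h1] := stationary_orbitE nb; have [m2 _ h2] := stationary_orbitE nb1.
rewrite -(h1 (maxn m1 m2)) /= ?leq_maxl // -orbit_from_past_step.
by rewrite (h2 (maxn m1 m2).+1) //= leqW // leq_maxr.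
Qed.

Lemma measurable_stationary_orbit :
  measurable_fun (setT : set (g_sigma_algebraType (queue_events sigma r N)))
    (stationary_orbit : g_sigma_algebraType (queue_events sigma r N) -> nat).
Proof.
set G := g_sigma_algebraType _.
have mt k : measurable_fun (setT : set G) (theta k : G -> G).
  exact: (measurable_theta_queue hqueue).
have mu : measurable (unbounded : set G).
  apply: (@measurable_loynes_unbounded _ G) => //.
  exact: (measurable_xi_queue hqueue (-1) (fun x => x%:~R : R)).
have ml n : measurable_fun (setT : set G) (orbit_from_past n : G -> nat).
  have : measurable_fun (setT : set G) (orbit (fun=> 0%N) n : G -> nat).
    elim: n => [|n IHn]; first exact: measurable_cst.
    apply: (@measurable_nat_pick _ G _ _ (orbit (fun=> 0%N) n)
      (fun k w => orbit_step k (xi_ n%:Z w))) => // k.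
    exact: (measurable_xi_queue hqueue n%:Z (orbit_step k)).
  by move=> h; exact: (measurableT_comp h (mt _)).
apply: (@measurable_nat_eventually _ G
  (fun n w => if w \in unbounded then 0%N else orbit_from_past n w)).
  move=> n; apply: measurable_fun_ifT => //.
  apply: (measurable_fun_bool true).
  rewrite setTI (_ : _ @^-1` _ = unbounded) //.
  by apply/seteqP; split=> w h; [exact: set_mem h|exact: mem_set h].
move=> w; case: (boolP (w \in unbounded)) => [|/negP]; rewrite inE => hw.
  apply: nearW => n; rewrite /stationary_orbit xgetPN // => x [m _ hx].
  have [n' hn'] := hw x.
  have := loynes_homo (theta (-1)) (xi_real sigma r N (-1)) w (leq_maxr m n').
  move=> /(lt_le_trans hn'); rewrite (loynes_orbit_size hqueue).
  have /= := hx (maxn m n') (leq_maxl _ _); rewrite /orbit_from_past => ->.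
  by rewrite ltxx.
exact: stationary_orbitE.
Qed.

Let unbounded_null : P unbounded = 0%E.
Proof.
have h := @loynes_xi_null _ _ _ _ _ _ _ _ _ _ hqueue (-1) (-1) 1 0 (or_intror erefl).
rewrite mul1r addr0 in h; rewrite -[RHS](h drift_neg) /unbounded.
by congr (P (loynes_unbounded _ _)); apply/funext => w; rewrite mul1r addr0.
Qed.

Let bounded_ae : {ae P, forall w, ~ unbounded w}.
Proof.
apply: ae_not_null unbounded_null; apply: measurable_loynes_unbounded => //.
apply: (measurable_queue_fun hqueue).
exact: (measurable_xi_queue hqueue (-1) (fun x => x%:~R : R)).
Qed.

Lemma stationary_orbit_regime :
  stationary_ergodic_regime P sigma r N theta stationary_orbit.
Proof.
split.
- exact: (measurable_queue_fun hqueue measurable_stationary_orbit).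
- apply: filterS bounded_ae => w nb n.
  rewrite /U /= addrC thetaD stationary_orbit_step ?unbounded_theta //.
  by rewrite (xi_shift hqueue) add0r.
- move=> A hA; apply: (zero_one_queue hqueue).
  move: A hA; apply: smallest_sub; first exact: smallest_sigma_algebra.
  move=> _ [n _ [B mB <-]].
  have := measurableT_comp measurable_stationary_orbit (measurable_theta_queue hqueue n).
  exact.
Qed.

Lemma regime_orbit (Y : T -> nat) w (n : nat) :
  (forall k : int, U theta (k + 1) Y w = orbit_step (U theta k Y w) (xi_ k w)) ->
  Y (theta n%:Z w) = orbit Y n w.
Proof.
move=> hY; elim: n => [|n IHn]; first by rewrite theta0.
by rewrite /= -IHn -[RHS]hY /U /= intS addrC.
Qed.

Let walk_unbounded_below : {ae P, forall w, forall K : R,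
  exists n, walk sigma r N n w <= K}.
Proof.
pose e : R := - drift P lambda sigma rho / 2.
have e0 : 0 < e by rewrite divr_gt0 // oppr_gt0.
have neg : drift P lambda sigma rho + e < 0.
  by rewrite /e; move: drift_neg; generalize (drift P lambda sigma rho) => D; lra.
apply: filterS (walk_le_ae hqueue neg) => w [K hK] L.
pose n := (Num.truncn ((`|K| + `|L|) / e)).+1.
exists n; have := hK n; have : `|K| + `|L| < n%:R * e.
  by rewrite -ltr_pdivrMr // truncnS_gt.
have := ler_norm K; have := ler_norm (- L); rewrite normrN; lra.
Qed.

(** Both regimes obey the same recursion and merge almost surely.  As the
    probability that they differ at time n does not depend on n, it is 0. *)
Lemma regime_unique (Y : T -> nat) :
  stationary_ergodic_regime P sigma r N theta Y ->
  {ae P, forall w, Y w = stationary_orbit w}.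
Proof.
move=> [mY Yrec _]; have [mX Xrec _] := stationary_orbit_regime.
set X := stationary_orbit in mX Xrec *.
pose D : set T := [set w | Y w != X w].
have mD : measurable D.
  rewrite (_ : D = ~` \bigcup_k (Y @^-1` [set k] `&` X @^-1` [set k])).
    apply: measurableC; apply: bigcupT_measurable => k.
    by apply: measurableI; exact: measurable_nat_fiber.
  apply/seteqP; split=> w /=.
    by move=> /eqP h [k _ [/= e1 e2]]; apply: h; rewrite e1.
  by move=> h; apply/eqP => e; apply: h; exists (X w).
have merge : {ae P, forall w, \forall n \near \oo, Y (theta n%:Z w) = X (theta n%:Z w)}.
  apply: filterS3 Yrec Xrec walk_unbounded_below => w hY hX hw.
  have [n hn] := hw (- ((Y w)%:R + (X w)%:R)).
  exists n => // m /= nm; rewrite !regime_orbit // -(subnK nm) addnC.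
  rewrite !(orbit_size_cat hqueue).
  rewrite (_ : orbit Y n w = orbit X n w) //.
  by apply: (orbit_size_coalesce); move: hn; have := ler0n R (X w); have := ler0n R (Y w); lra.
have PD : P D = 0%E.
  have cv : \int[P]_w \1_D (theta n%:Z w) @[n --> \oo] --> (\int[P]_w (0 : R)).
    apply: (@Rdominated_convergence _ _ _ _ _ _ _ (fun=> 1)).
    - exact: measurableT.
    - move=> n; apply: measurableT_comp => //; exact: measurable_indic.
    - exact: measurable_cst.
    - apply: filterS merge => w hw _; apply: cvg_near_cst.
      by apply: filterS hw => n hn; rewrite indicE memNset // /D /= hn eqxx.
    - exact: (finite_measure_integrable_cst P 1 measurableT).
    - move=> n; apply: aeW => w _; rewrite indicE.
      by case: (_ \in D); rewrite ?normr1 ?normr0.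
  rewrite Rintegral_prob_cst in cv.
  have e n : \int[P]_w \1_D (theta n%:Z w) = fine (P D).
    rewrite -[RHS](Rintegral_setT_indic P mD).
    apply: (Rintegral_comp_preserving (@mtheta n%:Z) (@thetaP n%:Z) measurableT).
    by apply: bounded_integrable => //; exact: bounded_measurable_indic.
  rewrite (_ : (fun n : nat => _) = (fun=> fine (P D))) in cv; last by apply/funext.
  have := cvg_unique _ cv (cvg_cst _) => h.
  by rewrite -[LHS]fineK ?fin_num_measure // -h.
exists D; split => // w /= h; exact/eqP.
Qed.

(** The orbits started at the times -k all have a size at most C at time 0, for
    a random C that does not depend on k.  Once the walk has gone down by C plus
    the size of the stationary orbit, all of them have merged with it. *)
Lemma stationary_orbit_coupling (Q0 : T -> nat) :
  P.-integrable setT (fun w => (Q0 w)%:R%:E) ->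
  strong_coupling_convergent P theta (orbit Q0) stationary_orbit.
Proof.
move=> Q0i; have [mX Xrec _] := stationary_orbit_regime.
set X := stationary_orbit in mX Xrec *.
pose e : R := - drift P lambda sigma rho / 2.
have e0 : 0 < e by rewrite divr_gt0 // oppr_gt0.
have neg : drift P lambda sigma rho + e < 0.
  by rewrite /e; move: drift_neg; generalize (drift P lambda sigma rho) => D; lra.
have h1 := walk_backward_le_ae hqueue neg.
have h2 := @stationary_sublinear _ _ _ P (theta (-1)) (@mtheta (-1)) (@thetaP (-1))
  (fun w => (Q0 w)%:R) e e0 Q0i.
have V : {ae P, forall w, exists C : R,
    forall k : nat, (orbit Q0 k (theta (- k%:Z) w))%:R <= C}.
  apply: filterS3 bounded_ae h1 h2 => w nb [K1 hK1] [K2 hK2].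
  have [K3 hK3] := loynes_boundedP nb; exists (`|K1| + `|K2| + K3%:R) => k.
  rewrite orbit_size_max ge_max; apply/andP; split.
    have := hK1 k; have := hK2 k; rewrite (iter_thetaN1 hqueue).
    have := ler_norm K1; have := ler_norm K2; have := ler0n R K3; lra.
  rewrite -(loynes_orbit_size hqueue); have := hK3 k.
  have := normr_ge0 K1; have := normr_ge0 K2; lra.
apply: filterS3 Xrec walk_unbounded_below V => w hX hw [C hC].
have C0 : 0 <= C by exact: le_trans (ler0n _ _) (hC 0%N).
have [n0 hn0] := hw (- (C + (X w)%:R)).
(* every coupling time from -k is at most n0 *)
apply: (@le_lt_trans _ _ (n0%:~R)%:E); last exact: ltry.
apply: ub_ereal_sup => _ [k _ <-]; apply: ereal_inf_lbound.
exists n0%:Z => //=; split; first by lia.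
rewrite addnC /U /= (orbit_size_cat hqueue) -thetaD subrr theta0 (regime_orbit _ hX).
apply: orbit_size_coalesce.
  by have := hC k; have := ler0n R (X w); move: hn0; lra.
by move: hn0 C0; lra.
Qed.

End stable_queue.

(** * Convergence to infinity of the unstable queue *)
Section limit_in_distribution.
Context d (T : measurableType d) (R : realType) (P : probability T R).
Local Notation E := {ptws nat -> \bar R}.

Lemma ptws_cvg (u : nat -> E) (l : E) :
  (forall k, u n k @[n --> \oo] --> l k) -> u n @[n --> \oo] --> l.
Proof. by move=> h; apply/(@pointwise_cvgP nat (\bar R) _ l) => k; exact: h. Qed.

(** By continuity the function is the limit of its values at truncated
    sequences, and these are functions of finitely many integers.  This avoids
    comparing the Borel sets of the product with the product sigma-algebra. *)
Lemma measurable_comp_nat_sequence (f : E -> R) (X : nat -> T -> nat) :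
  continuous f -> (forall k, measurable_fun setT (X k)) ->
  measurable_fun setT (fun w => f (fun k => (X k w)%:R%:E)).
Proof.
move=> cf mX.
pose pre m (s : nat -> nat) : E := fun k => if (k < m)%N then (s k)%:R%:E else 0%E.
have fin m (g : (nat -> nat) -> R) :
    (forall s t, (forall k, (k < m)%N -> s k = t k) -> g s = g t) ->
    measurable_fun setT (fun w => g (X ^~ w)).
  elim: m g => [|m IHm] g hg.
    rewrite (_ : (fun w => _) = (fun=> g (fun=> 0%N))).
      exact: measurable_cst.
    by apply/funext => w; apply: hg.
  rewrite (_ : (fun w => _) = (fun w =>
    (fun j w' => g (fun k => if k == m then j else X k w')) (X m w) w)); last first.
    by apply/funext => w; apply: hg => k _; case: eqP => [->|].
  apply: (@measurable_nat_pick _ _ _ _ (X m)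
    (fun j w => g (fun k => if k == m then j else X k w))) => // j.
  apply: (IHm (fun s => g (fun k => if k == m then j else s k))) => s t st.
  apply: hg => k; rewrite ltnS leq_eqVlt; case: eqP => //= _; exact: st.
apply: (@measurable_fun_cvg _ _ _ _ (fun m w => f (pre m (X ^~ w)))).
  move=> m; apply: (fin m (fun s => f (pre m s))) => s t st.
  by congr f; apply/funext => k; rewrite /pre; case: ifP => // km; rewrite st.
move=> w _; apply: (continuous_cvg _ (cf _)); apply: ptws_cvg => k.
by apply: cvg_near_cst; exists k.+1 => // m /= km; rewrite /pre km.
Qed.

Lemma expectation_bounded (g : T -> R) : bounded_measurable g ->
  ('E_P[g] = (\int[P]_w g w)%R%:E)%E.
Proof.
move=> bg; rewrite unlock /Rintegral fineK //.
exact: (integrable_fin_num measurableT (bounded_integrable P measurableT bg)).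
Qed.

Lemma cvg_in_distribution_pinfty (Q : nat -> T -> nat) :
  (forall n, measurable_fun setT (Q n)) ->
  {ae P, forall w, (Q n w)%:R%:E @[n --> \oo] --> (+oo : \bar R)%E} ->
  cvg_in_distribution P (E := E) (fun n w k => (Q (n + k)%N w)%:R%:E)
    (fun w k => +oo%E).
Proof.
move=> mQ Qoo f cf [M fM].
have bf n : bounded_measurable (f \o (fun w k => (Q (n + k)%N w)%:R%:E)).
  split; last by exists M => w; exact: fM.
  exact: (@measurable_comp_nat_sequence f (fun k => Q (n + k)%N)).
have bl : bounded_measurable (f \o (fun (w : T) (k : nat) => +oo%E)).
  by split; [exact: measurable_cst | exists M => w; exact: fM].
rewrite expectation_bounded //.
under eq_fun => n do rewrite expectation_bounded //.
apply: cvg_EFin; first exact: nearW.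
apply: (@Rdominated_convergence _ _ _ _ _ _ _ (fun=> M)).
- exact: measurableT.
- by move=> n; case: (bf n).
- by case: bl.
- apply: filterS Qoo => w hw _; apply: (continuous_cvg _ (cf _)).
  apply: ptws_cvg => k.
  exact: (cvg_comp _ _ (cvg_addnr k) hw).
- exact: (finite_measure_integrable_cst P M measurableT).
- by move=> n; apply: aeW => w _; exact: fM.
Qed.

End limit_in_distribution.

Theorem theorem3 (R : realType) (d : measure_display) (T : measurableType d)
    (P : probability T R) (theta : int -> T -> T) (lambda : R)
    (sigma r : int -> T -> R) (N : int -> R -> T -> nat) (rho : R -> R)
    (Q0 : T -> nat)
    (hqueue : control_retrial_queue P sigma r N theta lambda rho)
    (hQ0 : measurable_fun setT Q0) :
  (P.-integrable setT (fun w => (Q0 w)%:R%:E) ->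
   (lambda%:E * 'E_P[sigma 1%R] < laplace_transform rho lambda)%E ->
   exists X : T -> nat,
     [/\ stationary_ergodic_regime P sigma r N theta X,
         strong_coupling_convergent P theta (orbit_size sigma r N Q0) X &
         forall Y : T -> nat, stationary_ergodic_regime P sigma r N theta Y ->
           {ae P, forall w, Y w = X w}])
  /\
  ((lambda%:E * 'E_P[sigma 1%R] > laplace_transform rho lambda)%E ->
   exists Z : T -> \bar R,
     [/\ measurable_fun setT Z,
         cvg_in_distribution P (E := {ptws nat -> \bar R})
           (fun n w k => (orbit_size sigma r N Q0 (n + k) w)%:R%:E)
           (fun w k => U theta k%:Z Z w) &
         improper P (fun k => U theta k%:Z Z)]).
Proof.
have dE := driftE hqueue; split=> [Q0i lt|gt].
  have neg : drift P lambda sigma rho < 0.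
    by rewrite -lte_fin dE sube_lt0 // (laplace_fin_num hqueue) orbT.
  exists (stationary_orbit theta sigma r N); split.
  - exact: (stationary_orbit_regime hqueue neg).
  - exact: (stationary_orbit_coupling hqueue neg Q0i).
  - by move=> Y; exact: (regime_unique hqueue neg).
have pos : 0 < drift P lambda sigma rho.
  by rewrite -lte_fin dE sube_gt0.
exists (fun=> +oo%E); split; first exact: measurable_cst.
- apply: cvg_in_distribution_pinfty.
    elim=> [//|n IHn].
    apply: (@measurable_nat_pick _ _ _ _ (orbit_size sigma r N Q0 n)
      (fun k w => orbit_step k (xi sigma r N n%:Z w))) => // k.
    apply: (measurable_queue_fun hqueue).
    exact: (measurable_xi_queue hqueue n%:Z (orbit_step k)).
  apply: filterS (walk_cvg_pinfty_ae hqueue pos) => w hw.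
  apply/cvgeryP; apply: ger_cvgy hw; apply: nearW => n.
  exact: walk_le_orbit_size.
- move=> k; rewrite (_ : [set w | _] = setT) ?probability_setT //.
  by apply/seteqP; split.
Qed.
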